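(* For every constant $K$, the $K$-omitting problem for deterministic, acyclic, sound negotiations is in $\mathrm{PTIME}$: there is a polynomial-time algorithm that, given a deterministic, acyclic, sound negotiation $\mathcal{N}$, a set $P\subseteq N\times R$ with $|P|\le K$ and a set $B\subseteq N$, decides whether $\mathcal{N}$ has a successful run including $P$ and omitting $B$.
   Context: A negotiation is a tuple $\mathcal{N}=(\mathit{Proc},N,\mathit{dom},R,\delta)$ where $\mathit{Proc}$ is a finite set of processes, $N$ is a finite set of nodes, $\mathit{dom}:N\to 2^{\mathit{Proc}}\setminus\{\emptyset\}$, there are two distinguished nodes $n_{\mathit{init}},n_{\mathit{fin}}$ with $\mathit{dom}(n_{\mathit{init}})=\mathit{dom}(n_{\mathit{fin}})=\mathit{Proc}$, $R$ is a set of results, each node $n$ has a set $\mathit{out}(n)\subseteq R$ of results (nonempty for $n\neq n_{\mathit{fin}}$), and $\delta(n,a,p)\subseteq N$ is defined and nonempty exactly when $a\in\mathit{out}(n)$ and $p\in\mathit{dom}(n)$, with $p\in\mathit{dom}(n')$ for all $n'\in\delta(n,a,p)$. $\mathcal{N}$ is deterministic if every $\delta(n,a,p)$ is a singleton. A configuration is a map $C$ assigning to each process a nonempty set of nodes; $C_{\mathit{init}}(p)=\{n_{\mathit{init}}\}$, $C_{\mathit{fin}}(p)=\{n_{\mathit{fin}}\}$. A node $n$ is enabled in $C$ if $n\in C(p)$ for all $p\in\mathit{dom}(n)$. If $n$ is enabled and $a\in\mathit{out}(n)$ then $C\xrightarrow{(n,a)}C'$ with $C'(p)=\delta(n,a,p)$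 for $p\in\mathit{dom}(n)$, $C'(p)=C(p)$ otherwise. A run is a sequence $(n_1,a_1)(n_2,a_2)\cdots$ of such steps; a successful run is a finite run from $C_{\mathit{init}}$ to $C_{\mathit{fin}}$; $\mathcal{N}$ is sound if every finite run from $C_{\mathit{init}}$ can be extended to a successful run. The graph of $\mathcal{N}$ has vertex set $N$ and edges $n\to n'$ whenever $n'\in\delta(n,a,p)$ for some $a,p$; $\mathcal{N}$ is acyclic if this graph is. A run $(n_1,a_1)(n_2,a_2)\cdots$ omits $B\subseteq N$ if $n_i\notin B$ for all $i$; it includes $P\subseteq N\times R$ if every pair of $P$ occurs in it. *)

(* Defs.v *)
From mathcomp Require Import all_boot.
Set Implicit Arguments. Unset Strict Implicit. Unset Printing Implicit Defensive.

(* Processes are 0..nproc-1, nodes 0..nnode-1, results 0..nres-1.           *)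
(* Deterministic: delta(n,a,p) is a single node, given by the function dlt.  *)
(* Only values within the bounds are meaningful (accessors below enforce it).*)
Record negotiation := Negotiation {
  nproc : nat;
  nnode : nat;
  nres  : nat;
  ninit : nat;
  nfin  : nat;
  dom_t : nat -> nat -> bool;
  out_t : nat -> nat -> bool;
  dlt   : nat -> nat -> nat -> nat
}.

Section Neg.
Variable Ng : negotiation.

Definition is_proc p := p < nproc Ng.
Definition is_node n := n < nnode Ng.
Definition is_res a := a < nres Ng.
Definition indom n p := [&& is_node n, is_proc p & dom_t Ng n p].
Definition inout n a := [&& is_node n, is_res a & out_t Ng n a].

Definition wf_negotiation : Prop :=
  is_node (ninit Ng) /\ is_node (nfin Ng) /\ ninit Ng != nfin Ng /\
  (forall p, is_proc p -> indom (ninit Ng) p /\ indom (nfin Ng) p) /\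
  (forall n, is_node n -> exists p, indom n p) /\
  (forall a, ~~ inout (nfin Ng) a) /\
  (forall n, is_node n -> n != nfin Ng -> exists a, inout n a) /\
  (forall n a p, inout n a -> indom n p ->
      is_node (dlt Ng n a p) /\ indom (dlt Ng n a p) p).

(* Configurations: C p m = true iff node m \in C(p). *)
Definition config := nat -> nat -> bool.
Definition conf_eq (C C' : config) : Prop :=
  forall p, is_proc p -> forall m, C p m = C' p m.
Definition Cinit : config := fun _ m => m == ninit Ng.
Definition Cfin : config := fun _ m => m == nfin Ng.
Definition enabled (C : config) n : Prop :=
  is_node n /\ forall p, indom n p -> C p n.
Definition step (C : config) (na : nat * nat) (C' : config) : Prop :=
  let: (n, a) := na in
  [/\ enabled C n, inout n a &
      forall p, is_proc p -> forall m,
        C' p m = (if indom n p then m == dlt Ng n a p else C p m)].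

Fixpoint run (C : config) (s : seq (nat * nat)) (C' : config) : Prop :=
  match s with
  | [::] => conf_eq C C'
  | na :: s' => exists C1, step C na C1 /\ run C1 s' C'
  end.

Definition successful (s : seq (nat * nat)) : Prop := run Cinit s Cfin.

Definition sound : Prop :=
  forall s C, run Cinit s C -> exists s', run C s' Cfin.

Definition edge n n' : Prop :=
  exists a p, inout n a /\ indom n p /\ dlt Ng n a p = n'.

Inductive path_plus : nat -> nat -> Prop :=
  | pp_one n n' : edge n n' -> path_plus n n'
  | pp_cons n n' n'' : edge n n' -> path_plus n' n'' -> path_plus n n''.
Definition acyclic : Prop := forall n, ~ path_plus n n.

Definition includes (s : seq (nat * nat)) (P : seq (nat * nat)) : Prop :=
  forall x, x \in P -> x \in s.
Definition omits (s : seq (nat * nat)) (B : seq nat) : Prop :=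
  forall x, x \in s -> x.1 \notin B.

Definition has_run_incl_omit (P : seq (nat * nat)) (B : seq nat) : Prop :=
  exists s, successful s /\ includes s P /\ omits s B.

Definition valid_PB (P : seq (nat * nat)) (B : seq nat) : Prop :=
  (forall x, x \in P -> is_node x.1 /\ is_res x.2) /\
  (forall n, n \in B -> is_node n).

End Neg.

(* Unary is polynomially equivalent to the standard encoding here, since    *)
(* all numbers are bounded by the sizes of the tables.                       *)
Definition enc_nat (k : nat) : seq bool := nseq k true ++ [:: false].
Definition enc_nats (s : seq nat) : seq bool := flatten (map enc_nat s).

Definition enc_instance (Ng : negotiation) (P : seq (nat * nat)) (B : seq nat)
  : seq bool :=
  let nn := nnode Ng in let np := nproc Ng in let nr := nres Ng in
  enc_nats (
    [:: np; nn; nr; ninit Ng; nfin Ng]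
    ++ flatten [seq [seq nat_of_bool (indom Ng n p) | p <- iota 0 np] | n <- iota 0 nn]
    ++ flatten [seq [seq nat_of_bool (inout Ng n a) | a <- iota 0 nr] | n <- iota 0 nn]
    ++ flatten [seq flatten [seq
          [seq (if inout Ng n a && indom Ng n p then dlt Ng n a p else 0)
             | p <- iota 0 np] | a <- iota 0 nr] | n <- iota 0 nn]
    ++ [:: size P] ++ flatten [seq [:: x.1; x.2] | x <- P]
    ++ [:: size B] ++ B).

(* States 0..tm_Q-1, tape symbols 0..tm_S-1, 0 = blank, 1 = bit false,      *)
(* 2 = bit true.  Two-way infinite tape.                                     *)
Inductive move := MoveL | MoveR | Stay.

Record TM := MkTM {
  tm_Q : nat;
  tm_S : nat;
  tm_tr : nat -> nat -> nat * nat * move;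
  tm_start : nat;
  tm_acc : nat;
  tm_rej : nat
}.

Definition wf_TM (M : TM) : Prop :=
  3 <= tm_S M /\ tm_start M < tm_Q M /\ tm_acc M < tm_Q M /\ tm_rej M < tm_Q M /\
  tm_acc M != tm_rej M /\
  (forall q a, q < tm_Q M -> a < tm_S M ->
        (tm_tr M q a).1.1 < tm_Q M /\ (tm_tr M q a).1.2 < tm_S M).

(* configuration: state, reversed left part, head symbol, right part *)
Definition tm_conf := (nat * (seq nat * nat * seq nat))%type.

Definition tm_halted (M : TM) (q : nat) : bool := (q == tm_acc M) || (q == tm_rej M).

Definition tm_step (M : TM) (c : tm_conf) : tm_conf :=
  let: (q, (l, x, r)) := c in
  if tm_halted M q then c else
  let: (q', y, mv) := tm_tr M q x in
  match mv with
  | Stay => (q', (l, y, r))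
  | MoveL => match l with
             | [::] => (q', ([::], 0, y :: r))
             | z :: l' => (q', (l', z, y :: r))
             end
  | MoveR => match r with
             | [::] => (q', (y :: l, 0, [::]))
             | z :: r' => (q', (y :: l, z, r'))
             end
  end.

Definition tm_input (w : seq bool) : seq nat := [seq (if b then 2 else 1) | b <- w].

Definition tm_init (M : TM) (w : seq bool) : tm_conf :=
  match tm_input w with
  | [::] => (tm_start M, ([::], 0, [::]))
  | x :: r => (tm_start M, ([::], x, r))
  end.

Definition tm_state_after (M : TM) (w : seq bool) (t : nat) : nat :=
  (iter t (tm_step M) (tm_init M w)).1.

Definition PTIME_promise (A : Type) (valid : A -> Prop) (enc : A -> seq bool)
  (answer : A -> Prop) : Prop :=
  exists (M : TM) (c d : nat), wf_TM M /\
    (forall w, tm_halted M (tm_state_after M w (c * size w ^ d + c))) /\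
    (forall x, valid x ->
        tm_state_after M (enc x) (c * size (enc x) ^ d + c) = tm_acc M <-> answer x).

(* Main.v *)
Require Import Defs.
From mathcomp Require Import all_boot zify.
From Stdlib Require Import FunctionalExtensionality Classical IndefiniteDescription.

Set Implicit Arguments. Unset Strict Implicit. Unset Printing Implicit Defensive.

(* Since the negotiation is sound and acyclic, every choice of one result per
   node yields a successful run, and this run executes exactly the nodes reached
   from the initial node by following the chosen results.  So the question is
   whether some choice reaches all nodes of P, with the prescribed results, and
   no node of B.  Nodes from which B can be avoided (with the results of P
   imposed) form a least fixpoint [Win].  Inside [Win], the choice exists iff K
   tokens can be moved from the initial node to the nodes of P such that a node
   is left by all the tokens on it at once, and only when no other travelling
   token can still reach it; this is a reachability problem on K-tuples.

   The three tables (reachability, [Win], token tuples) are computed by bounded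
   loops over arithmetic formulas.  Such a program is compiled to a machine with
   registers and one bit array, whose only loop repeats its body as many times as
   the input has symbols, so that running times are polynomial by construction;
   registers become marks on the tape of a one-tape Turing machine. *)

(** * Turing machines over finite types *)

(** The obstacle is that one strategy must serve all targets: whether two targets are compatible
    depends on the results chosen at nodes shared by their paths. Leaving a node only when no
    travelling token can return to it makes this local, since the result chosen there is never
    consulted again and need not be remembered. Such an order of moves always exists: take a
    travelling token of maximal rank, the rank being the number of reachable nodes. Every choice of
    results yields a successful run because soundness supplies an enabled node and enabledness does
    not depend on the result then taken; acyclicity bounds the length and lets no node occur twice.
    The machine must halt in time on every word, valid encoding or not, so running times cannot rest
    on properties of the instance. Each round of table filling settles one more rank; ranks are
    below the input length [L], and the ranks of [K] tokens sum to less than [L ^ K.+1], which gives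
    the numbers of rounds. *)

Definition upd (T : Type) (f : nat -> T) (i : nat) (v : T) : nat -> T :=
  fun j => if j == i then v else f j.

Lemma updE (T : Type) (f : nat -> T) i v : upd f i v i = v.
Proof. by rewrite /upd eqxx. Qed.

Lemma updN (T : Type) (f : nat -> T) i v j : j != i -> upd f i v j = f j.
Proof. by rewrite /upd => /negbTE ->. Qed.

Lemma upd_id (T : Type) (f : nat -> T) i : upd f i (f i) = f.
Proof. by apply: functional_extensionality => j; rewrite /upd; case: eqP => [->|]. Qed.

Lemma upd_upd (T : Type) (f : nat -> T) i v v' : upd (upd f i v) i v' = upd f i v'.
Proof. by apply: functional_extensionality => j; rewrite /upd; case: eqP. Qed.

Section FinMachine.

Variables (st cell : finType) (raw : nat -> cell).
Variables (tr : st -> cell -> st * cell * move) (s0 acc rej : st).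
Hypothesis acc_rej : acc != rej.

Definition sdec (q : nat) : st := nth s0 (enum st) q.
Definition senc (s : st) : nat := index s (enum st).
(* The tape symbols 0, 1, 2 of the input and the written symbols are decoded
   separately, so that decoding need not be injective. *)
Definition cdec (a : nat) : cell :=
  if a < 3 then raw a else nth (raw 0) (enum cell) (a - 3).
Definition cenc (c : cell) : nat := 3 + index c (enum cell).

Lemma sencK : cancel senc sdec.
Proof. by move=> s; rewrite /sdec nth_index // mem_enum. Qed.

Lemma cencK : cancel cenc cdec.
Proof. by move=> c; rewrite /cdec /cenc addKn nth_index // mem_enum. Qed.

Lemma senc_lt s : senc s < #|st|.
Proof. by rewrite /senc cardE index_mem mem_enum. Qed.

Lemma cenc_lt c : cenc c < 3 + #|cell|.
Proof. by rewrite /cenc cardE ltn_add2l index_mem mem_enum. Qed.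

Definition fin_TM : TM :=
  MkTM #|st| (3 + #|cell|)
    (fun q a => let: (s, c, mv) := tr (sdec q) (cdec a) in (senc s, cenc c, mv))
    (senc s0) (senc acc) (senc rej).

Lemma fin_TM_wf : wf_TM fin_TM.
Proof.
split; first by rewrite /= leq_addr.
do 3 (split; first exact: senc_lt).
split; first by rewrite /= (can_eq sencK).
move=> q a _ _ /=; case: (tr _ _) => [[s c] mv] /=.
by rewrite senc_lt cenc_lt.
Qed.

Definition fcfg := (st * nat * (nat -> cell))%type.

Definition mv_pos (mv : move) (p : nat) : nat :=
  match mv with MoveL => p.-1 | MoveR => p.+1 | Stay => p end.

(** No step moves left of position 0, although the tape of a [TM] is infinite both ways. The head
    position is therefore the length of the left part of a configuration, as [represents]
    requires. *)
Inductive fstep : fcfg -> fcfg -> Prop :=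
  FStep s p f s' x mv : s != acc -> s != rej -> tr s (f p) = (s', x, mv) ->
    (mv = MoveL -> 0 < p) -> fstep (s, p, f) (s', mv_pos mv p, upd f p x).

Fixpoint fsteps (t : nat) (c c' : fcfg) : Prop :=
  if t is t'.+1 then exists2 c1, fstep c c1 & fsteps t' c1 c' else c = c'.

Definition reach (T : nat) (c c' : fcfg) : Prop := exists2 t, t <= T & fsteps t c c'.

Lemma fsteps_trans t1 t2 c1 c2 c3 :
  fsteps t1 c1 c2 -> fsteps t2 c2 c3 -> fsteps (t1 + t2) c1 c3.
Proof.
elim: t1 c1 => [|t1 IH] c1 /=; first by move=> ->.
by case=> c' h1 h2 h3; exists c' => //; apply: IH h2 h3.
Qed.

Lemma reach_trans T1 T2 c1 c2 c3 :
  reach T1 c1 c2 -> reach T2 c2 c3 -> reach (T1 + T2) c1 c3.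
Proof.
by case=> t1 h1 r1 [t2 h2 r2]; exists (t1 + t2); [apply: leq_add | apply: fsteps_trans r1 r2].
Qed.

Lemma reach_refl T c : reach T c c.
Proof. by exists 0. Qed.

Lemma reach_leq T1 T2 c1 c2 : T1 <= T2 -> reach T1 c1 c2 -> reach T2 c1 c2.
Proof. by move=> h [t h1 r]; exists t => //; apply: leq_trans h. Qed.

Lemma reach1 c1 c2 : fstep c1 c2 -> reach 1 c1 c2.
Proof. by move=> h; exists 1 => //; exists c2. Qed.

Definition represents (c : tm_conf) (a : fcfg) : Prop :=
  let: (q, (l, x, r)) := c in
  [/\ q = senc a.1.1, size l = a.1.2 & forall i, cdec (nth 0 (rev l ++ x :: r) i) = a.2 i].

Lemma represents_step c a a' :
  fstep a a' -> represents c a -> represents (tm_step fin_TM c) a'.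
Proof.
case=> s p f s' y mv sacc srej trs hL; case: c => [q [[l x] r]] /= [-> sz hf].
rewrite /tm_halted /= !(can_eq sencK) (negbTE sacc) (negbTE srej) /= sencK.
have fp : cdec x = f p by rewrite -hf nth_cat size_rev sz ltnn subnn.
rewrite fp trs.
have hu i : cdec (nth 0 (rev l ++ cenc y :: r) i) = upd f p y i.
  rewrite /upd; case: eqP => [->|/eqP ne].
    by rewrite nth_cat size_rev sz ltnn subnn cencK.
  rewrite -hf !nth_cat size_rev sz; case: ltnP => // le.
  by case E: (i - p) => //; lia.
case: mv {trs} hL => /= hL.
- case: l sz hf hu => [|z l] /= sz hf hu; first by have := hL erefl; lia.
  by split=> //; [lia | move=> i; rewrite -hu rev_cons cat_rcons].
- case: r {hf} hu => [|z r] hu; split => //=; rewrite ?sz // => i;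
    rewrite -hu rev_cons cat_rcons //.
  (* A cell created at the right end holds the blank 0, which is also the default value of [nth], so
     lengthening the list changes no decoded cell. *)
  rewrite !nth_cat; case: ltnP => // _; case: (i - size (rev l)) => // j.
  by case: j => [|j] //=; rewrite !nth_nil.
- by split.
Qed.

Lemma represents_steps t c a a' :
  fsteps t a a' -> represents c a -> represents (iter t (tm_step fin_TM) c) a'.
Proof.
elim: t c a => [|t IH] c a; first by move=> <-.
case=> a1 h1 h2 hc; rewrite iterSr; apply: IH h2 _.
exact: represents_step h1 hc.
Qed.

Definition input_tape (w : seq bool) (p : nat) : cell := cdec (nth 0 (tm_input w) p).

Lemma represents_init w : represents (tm_init fin_TM w) (s0, 0, input_tape w).
Proof.
rewrite /tm_init /input_tape; case: (tm_input w) => [|x r] //=; split=> // i.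
by case: i => //= i; rewrite !nth_nil.
Qed.

Lemma halted_iter (M : TM) t c :
  tm_halted M c.1 -> iter t (tm_step M) c = c.
Proof.
by elim: t => //= t IH hc; rewrite (IH hc); case: c hc {IH} => q [[l x] r] /= ->.
Qed.

(** Halting configurations are fixed by [tm_step], so an upper bound on the halting time is enough
    to know the state at any later time. *)
Lemma fin_TM_state_after w T t s p f :
  reach T (s0, 0, input_tape w) (s, p, f) -> T <= t -> (s == acc) || (s == rej) ->
  tm_state_after fin_TM w t = senc s.
Proof.
case=> t' h1 h2 h3 hs.
have := represents_steps h2 (represents_init w).
rewrite /tm_state_after; set c := iter t' _ _ => hc.
have e : c.1 = senc s by case: c hc => q [[l x] r] [].
rewrite -(subnK (leq_trans h1 h3)) iterD -/c halted_iter // e.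
by rewrite /tm_halted /= !(can_eq sencK).
Qed.

End FinMachine.

(** * A machine moving marks on its tape *)

Section MarkMachine.

Variable h : nat.

(* A cell holds the set of registers whose current value is its position, an
   immutable input symbol and one writable bit; mark 0 stays on position 0. *)
Definition mcell : finType := ({ffun 'I_h.+1 -> bool} * option bool * bool)%type.

Definition has_mark (i : nat) (c : mcell) : bool := c.1.1 (inord i).
Definition set_mark (i : nat) (b : bool) (c : mcell) : mcell :=
  ([ffun j => if j == inord i then b else c.1.1 j], c.1.2, c.2).
Definition all_marks (c : mcell) : mcell := ([ffun _ => true], c.1.2, c.2).
Definition set_bit (c : mcell) : mcell := (c.1, true).

Definition raw_symbol (a : nat) : option bool :=
  if a == 1 then Some false else if a == 2 then Some true else None.
Definition raw_cell (a : nat) : mcell := ([ffun _ => false], raw_symbol a, false).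

(* [Instr i g g' t y n]: find the cell with mark [i], evaluate [t] on it, apply
   [g] to it and [g'] to its right neighbour, go back to position 0 and jump. *)
Record instr := Instr {
  i_at : nat; i_upd : mcell -> mcell; i_next : mcell -> mcell;
  i_test : mcell -> bool; i_yes : nat; i_no : nat }.

Definition i_halt : instr := Instr 0 id id predT 0 0.

Variable code : seq instr.

(** [None] is the start state, which puts every mark on cell 0. With program counter [pc],
    [(pc, None)] scans right for the mark, [(pc, Some (true, b))] is one cell past it with test
    result [b], and [(pc, Some (false, b))] walks back to mark 0. The two program counters beyond
    the code serve as accepting and rejecting states. *)
Definition mstate : finType := option ('I_(size code).+2 * option (bool * bool))%type.

Definition at_pc (i : nat) : mstate := Some (inord i, None).

Definition mtr (s : mstate) (c : mcell) : mstate * mcell * move :=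
  match s with
  | None => (at_pc 0, all_marks c, Stay)
  | Some (pc, None) =>
      let I := nth i_halt code pc in
      if has_mark (i_at I) c then (Some (pc, Some (true, i_test I c)), i_upd I c, MoveR)
      else (s, c, MoveR)
  | Some (pc, Some (true, b)) =>
      (Some (pc, Some (false, b)), i_next (nth i_halt code pc) c, MoveL)
  | Some (pc, Some (false, b)) =>
      let I := nth i_halt code pc in
      if has_mark 0 c then (at_pc (if b then i_yes I else i_no I), c, Stay)
      else (s, c, MoveL)
  end.

Definition m_acc : mstate := at_pc (size code).
Definition m_rej : mstate := at_pc (size code).+1.

Lemma at_pc_neq i j : i < (size code).+2 -> j < (size code).+2 -> i != j ->
  at_pc i != at_pc j.
Proof.
by move=> hi hj; apply: contra => /eqP [] /(congr1 val) /=; rewrite !inordK // => ->.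
Qed.

Lemma m_acc_rej : m_acc != m_rej.
Proof. by apply: at_pc_neq; lia. Qed.

Notation mreach := (reach mtr m_acc m_rej).
Notation mfsteps := (fsteps mtr m_acc m_rej).

Definition running (s : mstate) : bool := (s != m_acc) && (s != m_rej).

Lemma mreach1 s p f s' x mv :
  running s -> mtr s (f p) = (s', x, mv) -> (mv = MoveL -> 0 < p) ->
  mreach 1 (s, p, f) (s', mv_pos mv p, upd f p x).
Proof. by case/andP=> h1 h2 h3 h4; apply: reach1; apply: FStep. Qed.

Lemma running_pc pc : pc < size code -> running (at_pc pc).
Proof. by move=> hp; apply/andP; split; apply: at_pc_neq; lia. Qed.

Lemma running_mid pc x : running (Some (pc, Some x)).
Proof. by apply/andP; split; apply/eqP. Qed.

Lemma scan_right pc f q : pc < size code ->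
  (forall p, p < q -> ~~ has_mark (i_at (nth i_halt code pc)) (f p)) ->
  mreach q (at_pc pc, 0, f) (at_pc pc, q, f).
Proof.
move=> hpc; elim: q => [|q IH] hq; first exact: reach_refl.
rewrite -addn1; apply: reach_trans (IH _) _ => [p hp|]; first by apply: hq; lia.
have := @mreach1 (at_pc pc) q f (at_pc pc) (f q) MoveR (running_pc hpc).
rewrite upd_id /= addn1; apply=> //.
by rewrite inordK ?(negbTE (hq q _)) //; lia.
Qed.

Lemma return_left (pc : 'I_(size code).+2) b f q :
  (forall p, has_mark 0 (f p) = (p == 0)) ->
  mreach q.+1 (Some (pc, Some (false, b)), q, f)
    (at_pc (if b then i_yes (nth i_halt code pc) else i_no (nth i_halt code pc)), 0, f).
Proof.
move=> h0; elim: q => [|q IH].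
  set s' := at_pc _.
  have := @mreach1 (Some (pc, Some (false, b))) 0 f s' (f 0) Stay (running_mid _ _).
  by rewrite upd_id /=; apply=> //; rewrite h0 eqxx.
rewrite -(add1n q.+1); apply: reach_trans IH.
have := @mreach1 (Some (pc, Some (false, b))) q.+1 f (Some (pc, Some (false, b)))
   (f q.+1) MoveL (running_mid _ _).
by rewrite upd_id /=; apply=> //; rewrite h0.
Qed.

Lemma instr_reach pc I f f' q : pc < size code -> nth i_halt code pc = I ->
  (forall p, has_mark (i_at I) (f p) = (p == q)) ->
  f' = upd (upd f q (i_upd I (f q))) q.+1 (i_next I (f q.+1)) ->
  (forall p, has_mark 0 (f' p) = (p == 0)) ->
  mreach (q.*2 + 3)
    (at_pc pc, 0, f) (at_pc (if i_test I (f q) then i_yes I else i_no I), 0, f').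
Proof.
move=> hpc hI hq ef' h0.
(* [q] steps to reach the mark, one on its cell, one on the right neighbour, and [q.+1] to return
   and jump. *)
have -> : q.*2 + 3 = q + (1 + (1 + q.+1)) by lia.
apply: reach_trans (scan_right hpc _) _ => [p hp|].
  by rewrite hI hq; lia.
have epc : (inord pc : 'I_(size code).+2) = pc :> nat by rewrite inordK //; lia.
apply: (reach_trans (c2 := (Some (inord pc, Some (true, i_test I (f q))), q.+1,
   upd f q (i_upd I (f q))))).
  apply: (@mreach1 _ _ _ _ _ MoveR (running_pc hpc)) => //=.
  by rewrite epc hI hq eqxx.
apply: (reach_trans (c2 := (Some (inord pc, Some (false, i_test I (f q))), q, f'))).
  rewrite ef'; apply: (@mreach1 _ _ _ _ _ MoveL (running_mid _ _)) => //=.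
  by rewrite epc hI updN //; lia.
have := @return_left (inord pc) (i_test I (f q)) f' q h0.
by rewrite epc hI.
Qed.

Variable w : seq bool.

Definition input_symbol (p : nat) : option bool := nth None (map Some w) p.

(** Overwriting a register takes two instructions; in between, its mark is nowhere on the tape,
    hence the option type. *)
Definition tape (m : nat -> option nat) (mem : nat -> bool) (p : nat) : mcell :=
  ([ffun i : 'I_h.+1 => m i == Some p], input_symbol p, mem p).

Lemma has_mark_tape m mem i p : i <= h -> has_mark i (tape m mem p) = (m i == Some p).
Proof. by move=> hi; rewrite /has_mark ffunE inordK. Qed.

Lemma input_tape_start :
  mreach 1 (None, 0, input_tape raw_cell w) (at_pc 0, 0, tape (fun _ => Some 0) xpred0).
Proof.
have -> : tape (fun _ => Some 0) xpred0 =
    upd (input_tape raw_cell w) 0 (all_marks (input_tape raw_cell w 0)).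
  have e p : input_tape raw_cell w p = ([ffun=> false], input_symbol p, false).
    rewrite /input_tape /cdec /input_symbol /tm_input.
    case: (ltnP p (size w)) => hp.
      by rewrite !(nth_map false) //; case: (nth false w p).
    by rewrite (nth_default 0) ?size_map // (nth_default None) ?size_map.
  apply: functional_extensionality => p; rewrite /upd /tape !e.
  case: (p =P 0) => [->|/eqP ne]; congr (_, _, _); apply/ffunP => i; rewrite !ffunE //.
  by apply/eqP => -[] /esym/eqP; apply/negP.
by apply: (@mreach1 None 0 _ (at_pc 0) _ Stay).
Qed.

Definition inc_instr i t : instr := Instr i (set_mark i false) (set_mark i true) predT t t.
Definition remove_instr i t : instr := Instr i (set_mark i false) id predT t t.
Definition put_instr i j t : instr := Instr j (set_mark i true) id predT t t.
Definition bit_instr i t : instr := Instr i set_bit id predT t t.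
Definition test_instr i b y n : instr := Instr i id id b y n.

Section InstrSim.

Variables (m : nat -> option nat) (mem : nat -> bool) (pc q : nat).
Hypothesis hpc : pc < size code.
Hypothesis m0 : m 0 = Some 0.

Lemma tape_mark0 m' mem' : m' 0 = Some 0 ->
  forall p, has_mark 0 (tape m' mem' p) = (p == 0).
Proof. by move=> e p; rewrite has_mark_tape // e eq_sym. Qed.

Lemma tape_at i (hi : i <= h) : m i = Some q ->
  forall p, has_mark i (tape m mem p) = (p == q).
Proof. by move=> e p; rewrite has_mark_tape // e eq_sym. Qed.

Lemma set_mark_tape i b p (hi : i <= h) (v : option nat) :
  (v == Some p) = b ->
  set_mark i b (tape m mem p) = tape (upd m i v) mem p.
Proof.
move=> e; rewrite /set_mark /tape /=; congr (_, _, _); apply/ffunP => j; rewrite !ffunE /upd.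
by rewrite -val_eqE /= inordK //; case: (nat_of_ord j =P i).
Qed.

Lemma tape_upd_other i v p (o : option nat) : m i = o -> o != Some p -> v != Some p ->
  tape (upd m i v) mem p = tape m mem p.
Proof.
move=> e h1 h2; rewrite /tape; congr (_, _, _); apply/ffunP => j; rewrite !ffunE /upd.
by case: (nat_of_ord j =P i) => // ->; rewrite e (negbTE h1) (negbTE h2).
Qed.

Lemma inc_reach i t : 0 < i -> i <= h -> m i = Some q ->
  nth i_halt code pc = inc_instr i t ->
  mreach (q.*2 + 3) (at_pc pc, 0, tape m mem) (at_pc t, 0, tape (upd m i (Some q.+1)) mem).
Proof.
move=> i0 hi mi hI; apply: (instr_reach hpc hI) => /=.
- exact: tape_at.
- apply: functional_extensionality => p; rewrite /upd.
  case: eqP => [->|/eqP n1]; first by rewrite (set_mark_tape hi (v := Some q.+1)) ?eqxx.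
  case: eqP => [->|/eqP n2].
    by rewrite (set_mark_tape hi (v := Some q.+1)) //; apply/eqP => -[]; lia.
  by apply: (tape_upd_other mi); apply/eqP => -[] e; move: n1 n2; rewrite e eqxx.
- by apply: tape_mark0; rewrite updN //; lia.
Qed.

Lemma remove_reach i t : 0 < i -> i <= h -> m i = Some q ->
  nth i_halt code pc = remove_instr i t ->
  mreach (q.*2 + 3) (at_pc pc, 0, tape m mem) (at_pc t, 0, tape (upd m i None) mem).
Proof.
move=> i0 hi mi hI; apply: (instr_reach hpc hI) => /=.
- exact: tape_at.
- apply: functional_extensionality => p; rewrite /upd.
  case: (p =P q.+1) => [->|/eqP n1].
    by apply: (tape_upd_other mi) => //; apply/eqP => -[]; lia.
  case: eqP => [->|/eqP n2]; first by rewrite (set_mark_tape hi (v := None)).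
  by apply: (tape_upd_other mi) => //; apply/eqP => -[] e; move: n2; rewrite e eqxx.
- by apply: tape_mark0; rewrite updN //; lia.
Qed.

Lemma put_reach i j t : 0 < i -> i <= h -> j <= h -> m i = None -> m j = Some q ->
  nth i_halt code pc = put_instr i j t ->
  mreach (q.*2 + 3) (at_pc pc, 0, tape m mem) (at_pc t, 0, tape (upd m i (Some q)) mem).
Proof.
move=> i0 hi hj mi mj hI; apply: (instr_reach hpc hI) => /=.
- exact: tape_at.
- apply: functional_extensionality => p; rewrite /upd.
  case: (p =P q.+1) => [->|/eqP n1].
    by apply: (tape_upd_other mi) => //; apply/eqP => -[]; lia.
  case: eqP => [->|/eqP n2]; first by rewrite (set_mark_tape hi (v := Some q)) ?eqxx.
  by apply: (tape_upd_other mi) => //; apply/eqP => -[] e; move: n2; rewrite e eqxx.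
- by apply: tape_mark0; rewrite updN //; lia.
Qed.

Lemma bit_reach i t : i <= h -> m i = Some q ->
  nth i_halt code pc = bit_instr i t ->
  mreach (q.*2 + 3) (at_pc pc, 0, tape m mem) (at_pc t, 0, tape m (upd mem q true)).
Proof.
move=> hi mi hI; apply: (instr_reach hpc hI) => /=.
- exact: tape_at.
- apply: functional_extensionality => p; rewrite /upd /tape.
  case: (p =P q.+1) => [->|/eqP n1]; first by case: eqP => //; lia.
  by case: eqP => [->|].
- exact: tape_mark0.
Qed.

Lemma test_reach i b y n : i <= h -> m i = Some q ->
  nth i_halt code pc = test_instr i b y n ->
  mreach (q.*2 + 3) (at_pc pc, 0, tape m mem)
    (at_pc (if b (tape m mem q) then y else n), 0, tape m mem).
Proof.
move=> hi mi hI; apply: (instr_reach hpc hI) => /=.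
- exact: tape_at.
- apply: functional_extensionality => p; rewrite /upd.
  by case: eqP => [->|_] //; case: eqP => [->|].
- exact: tape_mark0.
Qed.

End InstrSim.

End MarkMachine.

(** * Loop programs over registers and a bit array *)

Inductive test :=
  | TZero of nat | TEq of nat & nat | TIn of nat & option bool | TBit of nat.

(* [PRep p] repeats [p] as many times as the input has symbols, so that every
   program runs in polynomial time. *)
Inductive prog :=
  | PSkip | PInc of nat | PZero of nat | PMov of nat & nat | PSetBit of nat
  | PSeq of prog & prog | PIf of test & prog & prog | PRep of prog.

Definition state := ((nat -> nat) * (nat -> bool))%type.

Section Exec.

Variable w : seq bool.

Definition eval_test (t : test) (s : state) : bool :=
  match t with
  | TZero i => s.1 i == 0
  | TEq i j => s.1 i == s.1 j
  | TIn i o => input_symbol w (s.1 i) == o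
  | TBit i => s.2 (s.1 i)
  end.

Fixpoint exec (p : prog) (s : state) : state :=
  match p with
  | PSkip => s
  | PInc i => (upd s.1 i (s.1 i).+1, s.2)
  | PZero i => (upd s.1 i 0, s.2)
  | PMov i j => (upd s.1 i (s.1 j), s.2)
  | PSetBit i => (s.1, upd s.2 (s.1 i) true)
  | PSeq p q => exec q (exec p s)
  | PIf t p q => if eval_test t s then exec p s else exec q s
  | PRep p => iter (size w) (exec p) s
  end.

End Exec.

(** Bounds the number of executed instructions; both branches of a conditional are simply added. A
    round of a loop adds the test and the increment of its counter, and leaving the loop costs a
    last test and the two instructions that reset the counter. As one instruction raises the maximal
    register value by at most one, this also bounds the growth of registers. *)
Fixpoint cost (L : nat) (p : prog) : nat :=
  match p with
  | PSkip => 0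
  | PInc _ | PSetBit _ => 1
  | PZero _ | PMov _ _ => 2
  | PSeq p q => cost L p + cost L q
  | PIf _ p q => cost L p + cost L q + 2
  | PRep p => L * (cost L p + 2) + 3
  end.

(* Register [i] is mark 2i+1; the counter of a loop of nesting depth [d] is
   mark 2d+2. *)
Definition reg_mark (i : nat) : nat := i.*2.+1.
Definition ctr_mark (d : nat) : nat := d.*2.+2.

Fixpoint code_size (p : prog) : nat :=
  match p with
  | PSkip => 0
  | PInc _ | PSetBit _ => 1
  | PZero _ => 2
  | PMov i j => if i == j then 0 else 2
  | PSeq p q => code_size p + code_size q
  | PIf _ p q => code_size p + code_size q + 2
  | PRep p => code_size p + 4
  end.

Definition test_bound (t : test) : nat :=
  match t with
  | TZero i | TIn i _ | TBit i => reg_mark i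
  | TEq i j => maxn (reg_mark i) (reg_mark j)
  end.

Fixpoint mark_bound (p : prog) (d : nat) : nat :=
  match p with
  | PSkip => 0
  | PInc i | PSetBit i | PZero i => reg_mark i
  | PMov i j => maxn (reg_mark i) (reg_mark j)
  | PSeq p q => maxn (mark_bound p d) (mark_bound q d)
  | PIf t p q => maxn (test_bound t) (maxn (mark_bound p d) (mark_bound q d))
  | PRep p => maxn (ctr_mark d) (mark_bound p d.+1)
  end.

(** * Compilation of loop programs to code for the mark machine *)

Section Compile.

Variable h : nat.

Definition compile_test (t : test) (y n : nat) : instr h :=
  match t with
  | TZero i => test_instr (reg_mark i) (has_mark 0) y n
  | TEq i j => test_instr (reg_mark i) (has_mark (reg_mark j)) y n
  | TIn i o => test_instr (reg_mark i) (fun c : mcell h => c.1.2 == o) y n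
  | TBit i => test_instr (reg_mark i) (fun c : mcell h => c.2) y n
  end.

(** [b] is the address of the first instruction and [d] the loop nesting depth. A loop counter is a
    mark that advances along the input, and the loop ends when the mark stands on a cell without
    input symbol; this ties the number of rounds to the input length. Testing mark 0 with [predT] is
    an unconditional jump. Moving a register to itself gets no code, because removing its mark would
    lose the value. *)
Fixpoint compile (p : prog) (d b : nat) : seq (instr h) :=
  match p with
  | PSkip => [::]
  | PInc i => [:: inc_instr h (reg_mark i) b.+1]
  | PZero i => [:: remove_instr h (reg_mark i) b.+1; put_instr h (reg_mark i) 0 b.+2]
  | PMov i j => if i == j then [::] else
      [:: remove_instr h (reg_mark i) b.+1; put_instr h (reg_mark i) (reg_mark j) b.+2]
  | PSetBit i => [:: bit_instr h (reg_mark i) b.+1]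
  | PSeq p q => compile p d b ++ compile q d (b + code_size p)
  | PIf t p q =>
      let e := b.+1 + code_size p in
      compile_test t b.+1 e.+1 ::
        compile p d b.+1 ++ test_instr 0 predT (e.+1 + code_size q) 0 :: compile q d e.+1
  | PRep p =>
      let e := b.+1 + code_size p in
      test_instr (ctr_mark d) (fun c : mcell h => c.1.2 != None) b.+1 e.+1 ::
        compile p d.+1 b.+1 ++
          [:: inc_instr h (ctr_mark d) b;
              remove_instr h (ctr_mark d) e.+2; put_instr h (ctr_mark d) 0 e.+3]
  end.

Lemma size_compile p d b : size (compile p d b) = code_size p.
Proof.
elim: p d b => //= [i j|p IHp q IHq|t p IHp q IHq|p IHp] d b.
- by case: eqP.
- by rewrite size_cat IHp IHq.
- by rewrite size_cat /= IHp IHq; lia.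
- by rewrite size_cat /= IHp; lia.
Qed.

Variable code : seq (instr h).

Definition code_at (b : nat) (c : seq (instr h)) : Prop :=
  exists pre post, code = pre ++ c ++ post /\ size pre = b.

Lemma code_at_cat b c1 c2 :
  code_at b (c1 ++ c2) -> code_at b c1 /\ code_at (b + size c1) c2.
Proof.
case=> pre [post [e <-]]; split.
- by exists pre, (c2 ++ post); rewrite e !catA.
- by exists (pre ++ c1), post; rewrite e !catA size_cat.
Qed.

Lemma code_at_cons b I c : code_at b (I :: c) ->
  [/\ b < size code, nth (i_halt h) code b = I & code_at b.+1 c].
Proof.
case=> pre [post [e <-]]; split.
- by rewrite e !size_cat /=; lia.
- by rewrite e nth_cat ltnn subnn.
- by exists (rcons pre I), post; rewrite cat_rcons size_rcons.
Qed.

Definition marks (u k : nat -> nat) (i : nat) : option nat :=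
  Some (if i == 0 then 0 else if odd i then u i./2 else k i./2.-1).

Lemma marks_reg u k i : marks u k (reg_mark i) = Some (u i).
Proof. by rewrite /marks /reg_mark /= odd_double /= uphalf_double. Qed.

Lemma marks_ctr u k d : marks u k (ctr_mark d) = Some (k d).
Proof. by rewrite /marks /ctr_mark /= odd_double /= doubleK. Qed.

Lemma marks_upd_reg u k i v : upd (marks u k) (reg_mark i) (Some v) = marks (upd u i v) k.
Proof.
apply: functional_extensionality => j; rewrite /upd /marks /reg_mark -(fun_if Some); congr Some.
case: (j =P i.*2.+1) => [->|ne] /=; first by rewrite odd_double /= uphalf_double eqxx.
by case: (j =P 0) => // j0; case: ifP => // o; case: eqP => // e; lia.
Qed.

Lemma marks_upd_ctr u k d v : upd (marks u k) (ctr_mark d) (Some v) = marks u (upd k d v).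
Proof.
apply: functional_extensionality => j; rewrite /upd /marks /ctr_mark -(fun_if Some); congr Some.
case: (j =P d.*2.+2) => [->|ne] /=; first by rewrite odd_double /= doubleK eqxx.
by case: (j =P 0) => // j0; case: ifP => // o; case: eqP => // e; lia.
Qed.

Variables (w : seq bool) (M : nat).
Hypothesis w_le : size w <= M.

Notation mreach := (reach (@mtr h code) (m_acc code) (m_rej code)).
Notation conf i s k := (at_pc code i, 0, tape h w (marks s.1 k) s.2).
Notation unit_time := (M.*2 + 3).

Lemma reach_units n q c c' : q <= M -> 0 < n ->
  mreach (q.*2 + 3) c c' -> mreach (n * unit_time) c c'.
Proof.
move=> hq hn; apply: reach_leq.
by apply: leq_trans (leq_pmull _ hn); rewrite leq_add2r leq_double.
Qed.

Lemma reset_reach b i j v v' s k m' :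
  code_at b [:: remove_instr h i b.+1; put_instr h i j b.+2] ->
  0 < i -> i <= h -> j <= h -> i != j ->
  marks s.1 k i = Some v -> v <= M ->
  marks s.1 k j = Some v' -> v' <= M ->
  m' = upd (marks s.1 k) i (Some v') ->
  mreach (2 * unit_time) (conf b s k) (at_pc code b.+2, 0, tape h w m' s.2).
Proof.
move=> /code_at_cons [hb hI /code_at_cons [hb' hI' _]] i0 hi hj ne mi hv mj hv' ->.
rewrite mul2n -addnn.
apply: (reach_trans (c2 := (at_pc code b.+1, 0, tape h w (upd (marks s.1 k) i None) s.2))).
  by rewrite -[unit_time]mul1n; apply: (reach_units hv) => //; apply: remove_reach hI.
rewrite -[unit_time]mul1n; apply: (reach_units hv') => //.
rewrite -(upd_upd (marks s.1 k) i None (Some v')).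
apply: put_reach hI' => //.
- by rewrite updN //; lia.
- by rewrite updE.
- by rewrite updN // eq_sym.
Qed.

Lemma test_reach_prog b t y n s k :
  b < size code -> nth (i_halt h) code b = compile_test t y n ->
  test_bound t <= h -> (forall i, s.1 i <= M) ->
  mreach unit_time (conf b s k) (conf (if eval_test w t s then y else n) s k).
Proof.
move=> hb hI ht hs; rewrite -[unit_time]mul1n.
case: t hI ht => [i|i j|i o|i] hI ht; apply: (reach_units (hs i)) => //.
- have -> : eval_test w (TZero i) s = has_mark 0 (tape h w (marks s.1 k) s.2 (s.1 i)).
    by rewrite has_mark_tape // eq_sym.
  by apply: test_reach hI => //; apply: marks_reg.
- have -> : eval_test w (TEq i j) s =
      has_mark (reg_mark j) (tape h w (marks s.1 k) s.2 (s.1 i)).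
    by rewrite has_mark_tape ?marks_reg /= 1?eq_sym //; move: ht; rewrite /= geq_max => /andP[].
  by apply: test_reach hI => //; [move: ht; rewrite /= geq_max => /andP[] | apply: marks_reg].
- by apply: test_reach hI => //; apply: marks_reg.
- by apply: test_reach hI => //; apply: marks_reg.
Qed.

Lemma compile_reach p : forall d b s k B,
  code_at b (compile p d b) -> mark_bound p d <= h ->
  (forall j, d <= j -> k j = 0) -> (forall i, s.1 i <= B) -> B + cost (size w) p <= M ->
  mreach (cost (size w) p * unit_time) (conf b s k) (conf (b + code_size p) (exec w p s) k)
  /\ forall i, (exec w p s).1 i <= B + cost (size w) p.
Proof.
elim: p => [|i|i|i j|i|p IHp q IHq|t p IHp q IHq|p IHp] d b s k B hc hm hk hs hB.
- by rewrite addn0; split; [apply: reach_refl | rewrite addn0].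
- have [hb hI _] := code_at_cons hc; split; last first.
    by move=> j /=; rewrite /upd; case: eqP => [_|_]; have := hs i; have := hs j; lia.
  apply: (@reach_units _ (s.1 i)) => //; first by have := hs i; lia.
  rewrite /= -marks_upd_reg addn1; apply: inc_reach hI => //; exact: marks_reg.
- split; last first.
    by move=> j /=; rewrite /upd; case: eqP => [_|_]; have := hs j; lia.
  rewrite /= -marks_upd_reg addn2.
  by apply: (reset_reach hc (v := s.1 i) (v' := 0)) => //;
    [apply: marks_reg | have := hs i; lia].
- split; last first.
    by move=> i' /=; rewrite /upd; case: eqP => [_|_]; have := hs i'; have := hs j; lia.
  move: hc hm; rewrite /=; case: (i =P j) => [->|/eqP ne] hc hm.
    by rewrite upd_id addn0; apply: reach_refl.
  rewrite -marks_upd_reg addn2.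
  apply: (reset_reach hc (v := s.1 i) (v' := s.1 j)) => //; rewrite ?marks_reg //.
  + by lia.
  + by lia.
  + by apply: contra ne => /eqP; rewrite /reg_mark => e; apply/eqP; lia.
  + by have := hs i; lia.
  + by have := hs j; lia.
- have [hb hI _] := code_at_cons hc; split; last by move=> j /=; have := hs j; lia.
  apply: (@reach_units _ (s.1 i)) => //; first by have := hs i; lia.
  rewrite /= addn1; apply: bit_reach hI => //; exact: marks_reg.
- move: hm; rewrite /= geq_max => /andP[hmp hmq].
  have [hcp hcq] := code_at_cat hc; rewrite size_compile in hcq.
  rewrite /= in hB.
  have [r1 b1] := IHp _ _ _ _ _ hcp hmp hk hs (ltac:(lia)).
  have [r2 b2] := IHq _ _ _ _ _ hcq hmq hk b1 (ltac:(lia)).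
  split; last by move=> i; have := b2 i; lia.
  by rewrite mulnDl addnA; apply: reach_trans r1 r2.
- move: hm; rewrite /= !geq_max => /and3P[hmt hmp hmq].
  rewrite /= in hB.
  have [hb hI /code_at_cat [hcp /code_at_cons [hb' hI' hcq]]] := code_at_cons hc.
  rewrite size_compile in hb' hI' hcq.
  have r0 := test_reach_prog (s := s) k hb hI hmt (ltac:(by move=> i; have := hs i; lia)).
  have [r1 b1] := IHp _ _ _ _ _ hcp hmp hk hs (ltac:(lia)).
  have [r2 b2] := IHq _ _ _ _ _ hcq hmq hk hs (ltac:(lia)).
  case: eval_test r0 => r0; split.
  + apply: (reach_leq (T1 := unit_time + (cost (size w) p * unit_time + unit_time))).
      by nia.
    apply: reach_trans r0 _; apply: reach_trans r1 _.
    rewrite -[unit_time]mul1n; apply: (@reach_units _ 0) => //.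
    have := test_reach w (exec w p s).2 (m := marks (exec w p s).1 k) (q := 0)
      hb' erefl (leq0n h) erefl hI'.
    by rewrite /=; congr (reach _ _ _ _ _ (at_pc _ _, _, _)); lia.
  + by move=> i; have := b1 i; lia.
  + apply: (reach_leq (T1 := unit_time + cost (size w) q * unit_time)); first by nia.
    apply: reach_trans r0 _.
    by move: r2; congr (reach _ _ _ _ _ (at_pc _ _, _, _)); lia.
  + by move=> i; have := b2 i; lia.
- move: hm; rewrite /= !geq_max => /andP[hmd hmp].
  rewrite /= in hB.
  have [hb hI /code_at_cat [hcp /code_at_cons [hb' hI' hcq]]] := code_at_cons hc.
  rewrite size_compile in hb' hI' hcq.
  set cp := cost (size w) p in hB *.
  have hk0 : upd k d 0 = k by rewrite -(hk d (leqnn d)) upd_id.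
  (* Generalised to a loop whose counter has already reached [c], with [n] rounds left. *)
  suff loop n : forall c s B, c + n = size w -> (forall i, s.1 i <= B) ->
      B + (n * (cp + 2) + 3) <= M ->
      mreach ((n * (cp + 2) + 3) * unit_time) (conf b s (upd k d c))
        (conf (b + (code_size p + 4)) (iter n (exec w p) s) k)
      /\ forall i, (iter n (exec w p) s).1 i <= B + (n * (cp + 2) + 3).
    by have := loop (size w) 0 s B erefl hs hB; rewrite hk0.
  elim: n => [|n IHn] c {hs hB}s {}B ec hs hB.
    split; last by move=> i /=; have := hs i; lia.
    have -> : (0 * (cp + 2) + 3) * unit_time = 1 * unit_time + 2 * unit_time by lia.
    have := test_reach w s.2 (m := marks s.1 (upd k d c)) (q := c) hb erefl
      hmd (ltac:(by rewrite marks_ctr updE)) hI.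
    rewrite /= /input_symbol nth_default ?size_map ?eqxx /=; last by lia.
    move=> /(reach_units (n := 1)) r1.
    apply: reach_trans (r1 (ltac:(lia)) isT) _.
    have -> : b + (code_size p + 4) = (b.+1 + code_size p).+3 by lia.
    apply: (reset_reach hcq (v := c) (v' := 0)); rewrite ?marks_ctr ?updE //.
      by lia.
    by rewrite marks_upd_ctr upd_upd hk0.
  have hk' j : d.+1 <= j -> upd k d c j = 0.
    by move=> hj; rewrite updN ?hk //; lia.
  have [r1 b1] := IHp _ _ s (upd k d c) B hcp hmp hk' hs (ltac:(rewrite -/cp; nia)).
  have [r2 b2] := IHn c.+1 (exec w p s) (B + cp) (ltac:(lia)) b1 (ltac:(nia)).
  rewrite iterSr; split; last by move=> i; have := b2 i; nia.
  apply: (reach_leq (T1 := 1 * unit_time + (cp * unit_time + (1 * unit_time +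
    (n * (cp + 2) + 3) * unit_time)))); first by nia.
  have := test_reach w s.2 (m := marks s.1 (upd k d c)) (q := c) hb erefl
      hmd (ltac:(by rewrite marks_ctr updE)) hI.
  have -> : (tape h w (marks s.1 (upd k d c)) s.2 c).1.2 != None.
    by rewrite /= /input_symbol (nth_map false) //; lia.
  move=> /(reach_units (n := 1)) r0.
  apply: reach_trans (r0 (ltac:(lia)) isT) _.
  apply: reach_trans r1 _; apply: reach_trans r2.
  apply: (@reach_units _ c) => //; first by lia.
  rewrite -[upd k d c.+1](upd_upd k d c) -(marks_upd_ctr _ _ _ c.+1).
  by apply: inc_reach hI' => //; rewrite marks_ctr updE.
Qed.

End Compile.

(** * Loop programs are decided in polynomial time *)

(** The base [n.+1] keeps the powers positive at [n = 0], which makes these functions closed under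
    sums; [poly_shape] returns to the form used in [PTIME_promise]. *)
Definition poly_bounded (f : nat -> nat) : Prop :=
  exists c d, forall n, f n <= c * n.+1 ^ d.

Lemma poly_const c : poly_bounded (fun _ => c).
Proof. by exists c, 0 => n; rewrite expn0 muln1. Qed.

Lemma poly_id : poly_bounded id.
Proof. by exists 1, 1 => n; rewrite expn1 mul1n. Qed.

Lemma poly_mul f g : poly_bounded f -> poly_bounded g -> poly_bounded (fun n => f n * g n).
Proof.
case=> c [d hf] [c' [d' hg]]; exists (c * c'), (d + d') => n.
by rewrite expnD mulnACA leq_mul.
Qed.

Lemma poly_add f g : poly_bounded f -> poly_bounded g -> poly_bounded (fun n => f n + g n).
Proof.
case=> c [d hf] [c' [d' hg]]; exists (c + c'), (d + d') => n.
rewrite mulnDl; apply: leq_add.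
- by apply: leq_trans (hf n) _; rewrite expnD leq_mul2l leq_pmulr ?expn_gt0 ?orbT.
- by apply: leq_trans (hg n) _; rewrite expnD leq_mul2l leq_pmull ?expn_gt0 ?orbT.
Qed.

Lemma poly_cost p : poly_bounded (fun n => cost n p).
Proof.
elim: p => [|i|i|i j|i|p IHp q IHq|t p IHp q IHq|p IHp] /=; try exact: poly_const.
- exact: poly_add.
- exact: (poly_add (poly_add IHp IHq) (poly_const 2)).
- exact: (poly_add (poly_mul poly_id (poly_add IHp (poly_const 2))) (poly_const 3)).
Qed.

Lemma poly_shape f : poly_bounded f -> exists c d, forall n, f n <= c * n ^ d + c.
Proof.
case=> c [d hf]; exists (c * 2 ^ d), d => n; apply: leq_trans (hf n) _.
(* For [n > 0] the bound follows from [n.+1 <= 2 * n]; for [n = 0] the summand [2 ^ d] suffices. *)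
have -> : c * 2 ^ d * n ^ d + c * 2 ^ d = c * ((2 * n) ^ d + 2 ^ d).
  by rewrite expnMn mulnDr mulnA.
rewrite leq_mul2l; apply/orP; right.
case: n => [|n].
  by rewrite exp1n (leq_trans _ (leq_addl _ _)) // expn_gt0.
apply: leq_trans (leq_addr _ _); case: d {hf} => // d.
by rewrite leq_exp2r //; lia.
Qed.

Theorem prog_decides (p : prog) (r : nat) :
  exists (M : TM) (c d : nat), wf_TM M /\
    (forall w, tm_halted M (tm_state_after M w (c * size w ^ d + c))) /\
    (forall w, tm_state_after M w (c * size w ^ d + c) = tm_acc M <->
      (exec w p (fun _ => 0, xpred0)).1 r <> 0).
Proof.
pose h := maxn (mark_bound p 0) (reg_mark r).
pose n := code_size p.
(* The last instruction tests register [r] and jumps to one of the two addresses beyond the code,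
   [n.+1] (accepting) or [n.+2] (rejecting). *)
pose code := compile h p 0 0 ++ [:: test_instr (reg_mark r) (has_mark 0) n.+2 n.+1].
pose space L := L + cost L p.
have [c [d hT]] : exists c d, forall L,
    1 + (cost L p * (2 * space L + 3) + (2 * space L + 3)) <= c * L ^ d + c.
  apply: poly_shape; apply: (poly_add (poly_const 1)).
  have h2 : poly_bounded (fun L => 2 * space L + 3).
    exact: (poly_add (poly_mul (poly_const 2) (poly_add poly_id (poly_cost p))) (poly_const 3)).
  exact: (poly_add (poly_mul (poly_cost p) h2) h2).
exists (fin_TM (raw_cell h) (@mtr h code) None (m_acc code) (m_rej code)), c, d.
have szc : size code = n.+1 by rewrite size_cat size_compile addn1.
have key w : tm_state_after (fin_TM (raw_cell h) (@mtr h code) None (m_acc code) (m_rej code))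
    w (c * size w ^ d + c) =
    senc (if (exec w p (fun _ => 0, xpred0)).1 r == 0 then m_rej code else m_acc code).
  set s := exec _ _ _.
  have hc1 : code_at code 0 (compile h p 0 0).
    by exists [::], [:: test_instr (reg_mark r) (has_mark 0) n.+2 n.+1].
  have hc2 : code_at code n [:: test_instr (reg_mark r) (has_mark 0) n.+2 n.+1].
    by exists (compile h p 0 0), [::]; rewrite cats0 size_compile.
  have [hb hI _] := code_at_cons hc2.
  have [r1 b1] := compile_reach (M := space (size w)) (leq_addr _ _) (s := (fun _ => 0, xpred0))
    (k := fun _ => 0) (B := 0) hc1 (leq_maxl _ _) (fun _ _ => erefl) (fun _ => leq0n _)
    (leq_addl _ _).
  have r2 := test_reach_prog w (M := space (size w)) (t := TZero r) (s := s)
    (fun _ => 0) hb hI (leq_maxr _ _) (fun i => leq_trans (b1 i) (leq_addl _ _)).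
  have e0 : marks (fun _ => 0) (fun _ => 0) = fun _ => Some 0.
    by apply: functional_extensionality => i; rewrite /marks; case: ifP => //; case: ifP.
  rewrite /= e0 in r1.
  have -> : (if s.1 r == 0 then m_rej code else m_acc code) =
      at_pc code (if eval_test w (TZero r) s then n.+2 else n.+1).
    by rewrite /m_rej /m_acc szc /=; case: ifP.
  apply: (fin_TM_state_after (m_acc_rej code) (reach_trans (input_tape_start code w)
    (reach_trans r1 r2))); first by have := hT (size w); rewrite mul2n.
  by rewrite /m_acc /m_rej szc; case: ifP; rewrite eqxx ?orbT.
split; first by apply: fin_TM_wf; apply: m_acc_rej.
split=> w.
  by rewrite key /tm_halted /=; case: ifP; rewrite eqxx ?orbT.
rewrite key /=; split.
  move=> /(can_inj (sencK None)); case: eqP => // _ e.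
  by move: (m_acc_rej code); rewrite -e eqxx.
by case: eqP.
Qed.

(** * Arithmetic expressions and table-filling statements *)

(* Arithmetic expressions; truth is being nonzero.  [Input e] is the [e]-th number
   of the input, [Tab e] the [e]-th entry of a boolean table, and [Ex x e]
   quantifies over values of [x] below the length of the input. *)
Inductive exp :=
  | Var of nat | Cst of nat | Add of exp & exp | Mul of exp & exp | Eq of exp & exp
  | Input of exp | Tab of exp | Ex of nat & exp.

Inductive stmt :=
  | SetTab of exp | When of exp & stmt | For of nat & stmt | Then of stmt & stmt.

Section Semantics.

Variables (L : nat) (nums : seq nat).

Fixpoint eval (e : exp) (env : nat -> nat) (mem : nat -> bool) : nat :=
  match e with
  | Var x => env x
  | Cst c => c
  | Add e1 e2 => eval e1 env mem + eval e2 env mem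
  | Mul e1 e2 => eval e1 env mem * eval e2 env mem
  | Eq e1 e2 => eval e1 env mem == eval e2 env mem
  | Input e => nth 0 nums (eval e env mem)
  | Tab e => mem (eval e env mem)
  | Ex x e => has (fun v => eval e (upd env x v) mem != 0) (iota 0 L)
  end.

Fixpoint run_stmt (s : stmt) (env : nat -> nat) (mem : nat -> bool) : nat -> bool :=
  match s with
  | SetTab e => upd mem (eval e env mem) true
  | When e s => if eval e env mem == 0 then mem else run_stmt s env mem
  | For x s => foldl (fun m v => run_stmt s (upd env x v) m) mem (iota 0 L)
  | Then s1 s2 => run_stmt s2 env (run_stmt s1 env mem)
  end.

End Semantics.

Fixpoint exp_vars (e : exp) : nat :=
  match e with
  | Var x => x.+1
  | Cst c => 0
  | Add e1 e2 | Mul e1 e2 | Eq e1 e2 => maxn (exp_vars e1) (exp_vars e2)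
  | Input e | Tab e => exp_vars e
  | Ex x e => maxn x.+1 (exp_vars e)
  end.

Fixpoint stmt_vars (s : stmt) : nat :=
  match s with
  | SetTab e => exp_vars e
  | When e s => maxn (exp_vars e) (stmt_vars s)
  | For x s => maxn x.+1 (stmt_vars s)
  | Then s1 s2 => maxn (stmt_vars s1) (stmt_vars s2)
  end.

(** Exponent of the input length [L] in the bound [eval_bound] on the value. For [L] at least 2, a
    sum costs one more than its larger operand, and a constant [c] is at most [L ^ c]. *)
Fixpoint exp_deg (e : exp) : nat :=
  match e with
  | Var x => 1
  | Cst c => c
  | Add e1 e2 => (maxn (exp_deg e1) (exp_deg e2)).+1
  | Mul e1 e2 => exp_deg e1 + exp_deg e2
  | Input e => 1
  | Eq _ _ | Tab _ | Ex _ _ => 0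
  end.

(** Sums and products are computed by counting up to an operand, so their operands determine the
    depth of the loops. Equality and table lookup need no counting, and an input lookup scans the
    input once whatever its index. *)
Fixpoint arg_deg (e : exp) : nat :=
  match e with
  | Var _ | Cst _ => 0
  | Add e1 e2 | Mul e1 e2 =>
      maxn (maxn (exp_deg e1) (exp_deg e2)) (maxn (arg_deg e1) (arg_deg e2))
  | Eq e1 e2 => maxn (arg_deg e1) (arg_deg e2)
  | Input e | Tab e | Ex _ e => arg_deg e
  end.

Fixpoint stmt_deg (s : stmt) : nat :=
  match s with
  | SetTab e => arg_deg e
  | When e s => maxn (arg_deg e) (stmt_deg s)
  | For x s => stmt_deg s
  | Then s1 s2 => maxn (stmt_deg s1) (stmt_deg s2)
  end.

Lemma eval_bound L nums e env mem : 1 < L -> (forall x, env x <= L) ->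
  (forall j, nth 0 nums j <= L) -> eval L nums e env mem <= L ^ exp_deg e.
Proof.
move=> hL henv hn.
have L1 d : 0 < L ^ d by rewrite expn_gt0; lia.
elim: e => [x|c|e1 IH1 e2 IH2|e1 IH1 e2 IH2|e1 IH1 e2 IH2|e IH|e IH|x e IH] /=.
- by rewrite expn1.
- by apply: ltnW; apply: leq_trans (ltn_expl c (isT : 1 < 2)) _; case: c => // c; rewrite leq_exp2r.
- rewrite expnS; apply: (@leq_trans (2 * L ^ maxn (exp_deg e1) (exp_deg e2))).
    rewrite mul2n -addnn; apply: leq_add; [apply: leq_trans IH1 _ | apply: leq_trans IH2 _];
      by rewrite leq_exp2l // ?leq_maxl ?leq_maxr.
  by rewrite leq_mul2r hL orbT.
- by rewrite expnD leq_mul.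
- by case: (_ == _).
- by rewrite expn1.
- by case: (mem _).
- by case: (has _ _).
Qed.

Lemma iter_mul T (f : T -> T) m n x : iter (m * n) f x = iter m (iter n f) x.
Proof. by elim: m => //= m IH; rewrite mulSn iterD IH. Qed.

(** * Compilation of expressions and statements to loop programs *)

Section Compile.

Variables (w : seq bool) (D : nat).
Let L := size w.

Definition rep_pow (n : nat) (p : prog) : prog := iter n PRep p.

Lemma exec_rep_pow n p s : exec w (rep_pow n p) s = iter (L ^ n) (exec w p) s.
Proof.
elim: n s => [|n IH] s //=; rewrite expnS iter_mul; exact: eq_iter.
Qed.

(** The number of rounds is always [L ^ D]; once [u] has reached [b] the remaining rounds are idle.
    Hence the requirement that operands be at most [L ^ D]. *)
Definition add_prog (a b u : nat) : prog :=
  PSeq (PZero u) (rep_pow D (PIf (TEq u b) PSkip (PSeq (PInc u) (PInc a)))).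

Lemma exec_add_prog (a b u : nat) s : a != b -> a != u -> b != u -> s.1 b <= L ^ D ->
  exec w (add_prog a b u) s = (upd (upd s.1 u (s.1 b)) a (s.1 a + s.1 b), s.2).
Proof.
move=> ab au bu hb; rewrite /= exec_rep_pow.
suff h n : iter n (exec w (PIf (TEq u b) PSkip (PSeq (PInc u) (PInc a)))) (upd s.1 u 0, s.2) =
    (upd (upd s.1 u (minn n (s.1 b))) a (s.1 a + minn n (s.1 b)), s.2).
  by rewrite h (minn_idPr hb).
elim: n => [|n IH].
  rewrite min0n addn0 /=; congr (_, _); apply: functional_extensionality => i.
  by rewrite /upd; case: (i =P a) => // ->; rewrite (negbTE au).
rewrite iterS IH /=; set r := upd (upd _ _ _) a _.
have ua : u != a by rewrite eq_sym.
have ra : r a = s.1 a + minn n (s.1 b) by rewrite /r updE.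
have ru : r u = minn n (s.1 b) by rewrite /r updN // updE.
have rb : r b = s.1 b by rewrite /r !updN // eq_sym.
rewrite ru rb; case: eqP => /= hn; congr (_, _).
  by have -> : minn n.+1 (s.1 b) = minn n (s.1 b) by lia.
have e : minn n.+1 (s.1 b) = (minn n (s.1 b)).+1 by lia.
rewrite updN // ra e addnS /r; apply: functional_extensionality => i; rewrite /upd.
by case: (i =P a) => // _; case: (i =P u).
Qed.

Definition mul_prog (a b c u v : nat) : prog :=
  PSeq (PZero u) (rep_pow D (PIf (TEq u a) PSkip (PSeq (PInc u) (add_prog c b v)))).

Lemma exec_mul_prog (a b c u v : nat) s : uniq [:: a; b; c; u; v] -> s.1 a <= L ^ D -> s.1 b <= L ^ D ->
  let s' := exec w (mul_prog a b c u v) s in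
  [/\ s'.1 c = s.1 c + s.1 a * s.1 b, s'.2 = s.2 &
      forall i, i \notin [:: c; u; v] -> s'.1 i = s.1 i].
Proof.
rewrite /= !inE !negb_or => /and5P[/and4P[ab ac au av] /and3P[bc bu bv] /andP[cu cv] uv _].
move=> ha hb; rewrite exec_rep_pow.
set f := exec w _.
have h n : let s' := iter n f (upd s.1 u 0, s.2) in
  [/\ s'.1 u = minn n (s.1 a), s'.1 c = s.1 c + minn n (s.1 a) * s.1 b, s'.2 = s.2 &
      forall i, i \notin [:: c; u; v] -> s'.1 i = s.1 i].
  elim: n => [|n]; first by rewrite /= updE updN // min0n mul0n addn0; split=> // i;
    rewrite !inE !negb_or => /and3P[_ iu _]; rewrite updN.
  rewrite iterS; case: (iter n f _) => r m /= [hu hc -> hi].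
  have ra : r a = s.1 a by apply: hi; rewrite !inE !negb_or ac au av.
  have rb : r b = s.1 b by apply: hi; rewrite !inE !negb_or bc bu bv.
  rewrite /f /=; case: (r u =P r a) => [e|ne] /=.
    have e' : minn n.+1 (s.1 a) = minn n (s.1 a) by lia.
    by rewrite e'; split.
  have e' : minn n.+1 (s.1 a) = (minn n (s.1 a)).+1 by lia.
  have cb : c != b by rewrite eq_sym.
  have hb' : (upd r u (r u).+1) b <= L ^ D by rewrite updN // rb.
  have uc : u != c by rewrite eq_sym.
  have /= -> := exec_add_prog (s := (upd r u (r u).+1, s.2)) cb cv bv hb'; split=> //=.
  + by rewrite updN // updN // updE hu e'.
  + by rewrite updE updN // updN // hc rb e' mulSn; lia.
  + move=> i hi'; move: (hi'); rewrite !inE !negb_or => /and3P[ic iu iv].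
    by rewrite !updN // hi.
have [_ hc h2 hi] := h (L ^ D).
by rewrite hc h2 (minn_idPr ha); split.
Qed.

(** [h] is the reading position, [c] the number of separators passed and [v] the number of ones seen
    in block [j]. At the separator that ends this block nothing changes any more; for an index
    beyond the last number [v] stays 0, the default value of [nth]. *)
Definition num_body (j h c v : nat) : prog :=
  PIf (TEq c j)
    (PIf (TIn h (Some true)) (PSeq (PInc h) (PInc v)) PSkip)
    (PIf (TIn h (Some false)) (PSeq (PInc c) (PInc h)) (PInc h)).

Definition num_step (j : nat) (x : nat * nat * nat) : nat * nat * nat :=
  let: (h, c, v) := x in
  if c == j then (if input_symbol w h == Some true then (h.+1, c, v.+1) else x)
  else if input_symbol w h == Some false then (h.+1, c.+1, v) else (h.+1, c, v).

Lemma num_step_ones j h v k n : k <= n ->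
  (forall i, i < k -> input_symbol w (h + i) = Some true) ->
  input_symbol w (h + k) != Some true ->
  iter n (num_step j) (h, j, v) = (h + k, j, v + k).
Proof.
move=> kn h1 h2; rewrite -(subnKC kn) addnC iterD.
have -> : iter k (num_step j) (h, j, v) = (h + k, j, v + k).
  elim: k {kn h2} h1 => [|k IH] h1; first by rewrite !addn0.
  rewrite iterS IH; last by move=> i hi; apply: h1; lia.
  by rewrite /= eqxx h1 // eqxx !addnS.
by elim: (n - k) => //= m ->; rewrite /= eqxx (negbTE h2).
Qed.

Lemma num_step_skip j h c v k : c != j ->
  (forall i, i < k -> input_symbol w (h + i) = Some true) ->
  input_symbol w (h + k) = Some false ->
  iter k.+1 (num_step j) (h, c, v) = (h + k.+1, c.+1, v).
Proof.
move=> cj h1 h2; rewrite iterS.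
have -> : iter k (num_step j) (h, c, v) = (h + k, c, v).
  elim: k {h2} h1 => [|k IH] h1; first by rewrite !addn0.
  rewrite iterS IH; last by move=> i hi; apply: h1; lia.
  by rewrite /= (negbTE cj) h1 //= !addnS.
by rewrite /= (negbTE cj) h2 eqxx addnS.
Qed.

(** Generalised to an arbitrary prefix already read and an arbitrary counter value [c], for
    induction on the remaining numbers. *)
Lemma num_step_nums pre rest n c j :
  w = pre ++ enc_nats rest -> size (enc_nats rest) <= n ->
  (iter n (num_step (c + j)) (size pre, c, 0)).2 = nth 0 rest j.
Proof.
elim: rest pre n c j => [|k rest IH] pre n c j ew hn.
  rewrite nth_nil.
  have hin h : size pre <= h -> input_symbol w h = None.
    by move=> hp; rewrite /input_symbol nth_default // size_map ew cats0.
  suff stay m h : size pre <= h -> (iter m (num_step (c + j)) (h, c, 0)).2 = 0 by exact: stay.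
  elim: m h => [|m IHm] h //= hp.
  rewrite -iterS iterSr /= hin //=.
  by case: eqP => _; apply: IHm; lia.
have ew' : w = (pre ++ enc_nat k) ++ enc_nats rest by rewrite -catA.
have sz : size (enc_nats (k :: rest)) = k.+1 + size (enc_nats rest).
  by rewrite /enc_nats /= size_cat /enc_nat size_cat size_nseq addn1.
have inE i : i <= k -> input_symbol w (size pre + i) = Some (i < k).
  move=> ik; rewrite /input_symbol (nth_map false); last first.
    by rewrite ew size_cat sz; lia.
  congr Some; rewrite ew' -catA nth_cat ltnNge leq_addr /= addKn.
  rewrite nth_cat /enc_nat size_cat size_nseq addn1 ltnS ik nth_cat size_nseq nth_nseq.
  by case: ltnP => // ki; have -> : i - k = 0 by lia.
have h1 i : i < k -> input_symbol w (size pre + i) = Some true.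
  by move=> ik; rewrite inE ?ik // ltnW.
have h2 : input_symbol w (size pre + k) = Some false by rewrite inE // ltnn.
case: j => [|j] /=.
  by rewrite addn0 (@num_step_ones c _ _ k) ?h2 //; lia.
have -> : n = (n - k.+1) + k.+1 by lia.
rewrite iterD num_step_skip //; last by apply/eqP; lia.
have -> : size pre + k.+1 = size (pre ++ enc_nat k).
  by rewrite size_cat /enc_nat size_cat size_nseq addn1.
by rewrite addnS -addSn; apply: IH => //; lia.
Qed.

Lemma exec_num_body (j h c v : nat) s n : uniq [:: j; h; c; v] ->
  let s' := iter n (exec w (num_body j h c v)) s in
  [/\ (s'.1 h, s'.1 c, s'.1 v) = iter n (num_step (s.1 j)) (s.1 h, s.1 c, s.1 v), s'.2 = s.2 &
      forall i, i \notin [:: h; c; v] -> s'.1 i = s.1 i].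
Proof.
rewrite /= !inE !negb_or => /and4P[/and3P[jh jc jv] /andP[hc hv] cv _].
elim: n => [|n]; first by split.
rewrite !iterS; case: (iter n _ s) => r m /= [e -> hi]; rewrite -e.
have rj : r j = s.1 j by apply: hi; rewrite !inE !negb_or jh jc jv.
rewrite /= rj.
have [ch vh vc] : [/\ c != h, v != h & v != c] by rewrite ![_ == h]eq_sym [v == c]eq_sym.
case: ifP => _ /=; case: ifP => _ /=; split=> //;
  rewrite ?updE ?(updN _ _ hc, updN _ _ hv, updN _ _ cv, updN _ _ ch, updN _ _ vh, updN _ _ vc, updE) //;
  by move=> i hi'; move: (hi'); rewrite !inE !negb_or => /and3P[ih ic iv]; rewrite ?updN // hi.
Qed.

(** Variables occupy the registers of their own number; the result goes to [t], and the registers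
    above [t] are scratch. A quantifier uses register [x] for its running value, after saving the
    old value in [t.+1], and restores it at the end. *)
Fixpoint compile_exp (e : exp) (t : nat) : prog :=
  match e with
  | Var x => PMov t x
  | Cst c => PSeq (PZero t) (iter c (PSeq (PInc t)) PSkip)
  | Add e1 e2 =>
      PSeq (compile_exp e1 t) (PSeq (compile_exp e2 t.+1) (add_prog t t.+1 t.+2))
  | Mul e1 e2 =>
      PSeq (compile_exp e1 t.+1) (PSeq (compile_exp e2 t.+2)
        (PSeq (PZero t) (mul_prog t.+1 t.+2 t t.+3 t.+4)))
  | Eq e1 e2 =>
      PSeq (compile_exp e1 t.+1) (PSeq (compile_exp e2 t.+2)
        (PSeq (PZero t) (PIf (TEq t.+1 t.+2) (PInc t) PSkip)))
  | Input e =>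
      PSeq (compile_exp e t.+1) (PSeq (PZero t) (PSeq (PZero t.+2) (PSeq (PZero t.+3)
        (PRep (num_body t.+1 t.+2 t.+3 t)))))
  | Tab e =>
      PSeq (compile_exp e t.+1) (PSeq (PZero t) (PIf (TBit t.+1) (PInc t) PSkip))
  | Ex x e =>
      PSeq (PMov t.+1 x) (PSeq (PZero t) (PSeq (PZero x) (PSeq
        (PRep (PSeq (compile_exp e t.+2)
          (PSeq (PIf (TZero t.+2) PSkip (PSeq (PZero t) (PInc t))) (PInc x))))
        (PMov x t.+1))))
  end.

Fixpoint compile_stmt (s : stmt) (t : nat) : prog :=
  match s with
  | SetTab e => PSeq (compile_exp e t) (PSetBit t)
  | When e s => PSeq (compile_exp e t) (PIf (TZero t) PSkip (compile_stmt s t))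
  | For x s =>
      PSeq (PMov t x) (PSeq (PZero x) (PSeq (PRep (PSeq (compile_stmt s t.+1) (PInc x)))
        (PMov x t)))
  | Then s1 s2 => PSeq (compile_stmt s1 t) (compile_stmt s2 t)
  end.

Variable nums : seq nat.
Hypothesis w_nums : w = enc_nats nums.
Hypothesis L_gt1 : 1 < L.

Lemma num_le_size j : nth 0 nums j <= L.
Proof.
rewrite /L w_nums; elim: nums j => [|k r IH] j; first by rewrite nth_nil.
rewrite /enc_nats /= size_cat /enc_nat size_cat size_nseq addn1.
by case: j => [|j] /=; [lia | apply: leq_trans (IH j) _; apply: leq_addl].
Qed.

Lemma exec_compile_exp e : forall t s env, exp_vars e <= t ->
  (forall x, x < exp_vars e -> s.1 x = env x) -> (forall x, env x <= L) -> arg_deg e <= D ->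
  let s' := exec w (compile_exp e t) s in
  [/\ s'.1 t = eval L nums e env s.2, s'.2 = s.2 & forall x, x < t -> s'.1 x = s.1 x].
Proof.
have bound e' env mem : (forall x, env x <= L) -> exp_deg e' <= D ->
    eval L nums e' env mem <= L ^ D.
  move=> henv hd; apply: leq_trans (eval_bound e' mem L_gt1 henv num_le_size) _.
  by rewrite leq_exp2l.
elim: e => [x|c|e1 IH1 e2 IH2|e1 IH1 e2 IH2|e1 IH1 e2 IH2|e IH|e IH|x e IH] t s env.
- move=> /= ht he henv _; split=> //; first by rewrite updE he.
  by move=> y hy; rewrite updN //; lia.
- move=> _ _ _ _ /=.
  suff -> : exec w (iter c (PSeq (PInc t)) PSkip) (upd s.1 t 0, s.2) = (upd s.1 t c, s.2).
    by split=> //=; [rewrite updE | move=> y hy; rewrite updN //; lia].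
  rewrite -[c in RHS](add0n c); elim: c 0 => [|c IH] k /=; first by rewrite addn0.
  by rewrite updE upd_upd IH addSnnS.
- rewrite /= !geq_max => /andP[ht1 ht2] he henv /andP[/andP[d1 d2] /andP[a1 a2]].
  have := IH1 t s env ht1 (fun x hx => he x (leq_trans hx (leq_maxl _ _))) henv a1.
  set s1 := exec _ _ _ => -[v1 m1 r1].
  have := IH2 t.+1 s1 env (leqW ht2) _ henv a2.
  case=> [x hx|]; first by rewrite r1 ?he //; [exact: leq_trans hx (leq_maxr _ _) | lia].
  set s2 := exec _ _ _ => v2 m2 r2.
  have := @exec_add_prog t t.+1 t.+2 s2; rewrite /= => -> //=; try lia; last first.
    by rewrite v2; apply: bound.
  split.
  + by rewrite updE r2 // v1 v2 m1.
  + by rewrite m2 m1.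
  + by move=> x hx; rewrite !updN ?r2 ?r1 //; lia.
- rewrite /= !geq_max => /andP[ht1 ht2] he henv /andP[/andP[d1 d2] /andP[a1 a2]].
  have := IH1 t.+1 s env (leqW ht1) (fun x hx => he x (leq_trans hx (leq_maxl _ _))) henv a1.
  set s1 := exec _ _ _ => -[v1 m1 r1].
  have := IH2 t.+2 s1 env (leqW (leqW ht2)) _ henv a2.
  case=> [x hx|]; first by rewrite r1 ?he //; [exact: leq_trans hx (leq_maxr _ _) | lia].
  set s2 := exec _ _ _ => v2 m2 r2.
  have := @exec_mul_prog t.+1 t.+2 t t.+3 t.+4 (upd s2.1 t 0, s2.2).
  have n1 : t.+1 != t by lia.
  have n2 : t.+2 != t by lia.
  rewrite /= updE (updN _ _ n1) (updN _ _ n2) v2 r2 // v1.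
  case.
  + by rewrite !inE; lia.
  + exact: bound.
  + exact: bound.
  move=> v3 m3 hr; split=> [||x hx]; first by rewrite v3 m1.
    by rewrite m3 m2.
  by rewrite hr ?inE ?updN ?r2 ?r1 //; lia.
- rewrite /= !geq_max => /andP[ht1 ht2] he henv /andP[a1 a2].
  have := IH1 t.+1 s env (leqW ht1) (fun x hx => he x (leq_trans hx (leq_maxl _ _))) henv a1.
  set s1 := exec _ _ _ => -[v1 m1 r1].
  have := IH2 t.+2 s1 env (leqW (leqW ht2)) _ henv a2.
  case=> [x hx|]; first by rewrite r1 ?he //; [exact: leq_trans hx (leq_maxr _ _) | lia].
  set s2 := exec _ _ _ => v2 m2 r2.
  rewrite !(updN _ _ (_ : t.+1 != t)) ?(updN _ _ (_ : t.+2 != t)); try lia.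
  rewrite v2 r2 // v1 m1.
  by case: eqP => _ /=; rewrite ?updE ?m2 ?m1; split=> // x hx; rewrite !updN ?r2 ?r1 //; lia.
- rewrite /= => ht he henv a1.
  have := IH t.+1 s env (leqW ht) he henv a1.
  set s1 := exec _ _ _ => -[v1 m1 r1].
  rewrite -/L.
  set s2 := (_, s1.2).
  have [j2 h2 c2 z2] : [/\ s2.1 t.+1 = s1.1 t.+1, s2.1 t.+2 = 0, s2.1 t.+3 = 0 & s2.1 t = 0].
    by split; rewrite /s2 /= /upd; do ?case: eqP => //; lia.
  have m2 : s2.2 = s1.2 by [].
  have r2 x : x < t -> s2.1 x = s1.1 x by move=> hx; rewrite /= !updN //; lia.
  clearbody s2.
  have /exec_num_body -/(_ s2 L) : uniq [:: t.+1; t.+2; t.+3; t] by rewrite /= !inE; lia.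
  set s3 := iter _ _ _ => -[v3 m3 r3].
  have := @num_step_nums [::] nums L 0 (s1.1 t.+1) w_nums.
  rewrite h2 c2 z2 in v3; rewrite add0n -j2 -[size [::]]/0 -v3 -w_nums j2 v1 /= => -> //.
  split=> //; first by rewrite m3 m2.
  by move=> x hx; rewrite r3 ?r2 ?r1 ?inE //; lia.
- rewrite /= => ht he henv a1.
  have := IH t.+1 s env (leqW ht) he henv a1.
  set s1 := exec _ _ _ => -[v1 m1 r1].
  rewrite (updN _ _ (_ : t.+1 != t)); last by lia.
  rewrite v1 m1; case: (s.2 _) => /=; rewrite ?updE;
    by split=> // x hx; rewrite !updN ?r1 //; lia.
- rewrite /= geq_max => /andP[xt ht] he henv a1.
  rewrite -/L; set s0 := (upd _ x 0, s.2); set f := fun s : state => _.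
  have loop n : n <= L -> let s' := iter n f s0 in
    [/\ s'.1 t = has (fun v => eval L nums e (upd env x v) s.2 != 0) (iota 0 n),
        s'.2 = s.2, s'.1 x = n, s'.1 t.+1 = s.1 x &
        forall y, y < t -> y != x -> s'.1 y = s.1 y].
    elim: n => [|n IHn] nL.
      by split=> //= [|||y yt yx]; rewrite /upd; do ?case: eqP => //; lia.
    have := IHn (ltnW nL); rewrite iterS; set s1 := iter n f s0.
    move=> [v1 m1 x1 sv1 r1].
    have := IH t.+2 s1 (upd env x n) (leqW (leqW ht)) _ _ a1.
    case=> [y hy|y|].
    + rewrite /upd; case: eqP => [->//|/eqP yx].
      by rewrite r1 ?he //; lia.
    + by rewrite /upd; case: eqP => _ //; exact: ltnW.
    have -> : iota 0 n.+1 = iota 0 n ++ [:: n] by rewrite -addn1 iotaD.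
    rewrite has_cat /= orbF.
    set s2 := exec _ _ _ => v2 m2 r2.
    have tx : t != x by lia.
    have tx1 : t.+1 != x by lia.
    have tt1 : t.+1 != t by lia.
    have s2t : s2.1 t = s1.1 t by apply: r2; lia.
    have s2t1 : s2.1 t.+1 = s1.1 t.+1 by apply: r2; lia.
    have s2x : s2.1 x = n by rewrite r2 ?x1; lia.
    rewrite v2 m1; case: eqP => /= e0; split=> [||||y yt yx].
    + by rewrite updN // s2t v1 orbF.
    + by rewrite m2.
    + by rewrite updE s2x.
    + by rewrite updN // s2t1.
    + by rewrite updN // r2 ?r1 //; lia.
    + by rewrite updN // !updE orbT.
    + by rewrite m2.
    + by rewrite updE upd_upd updN 1?eq_sym // s2x.
    + by rewrite updN // upd_upd updN // s2t1.
    + by rewrite updN // upd_upd updN ?r2 ?r1 //; lia.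
  have [v m xv sv r] := loop L (leqnn L).
  rewrite updN; last by lia.
  split=> // y yt; rewrite /upd; case: eqP => [->//|/eqP yx]; exact: r.
Qed.

Lemma exec_compile_stmt st : forall t s env, stmt_vars st <= t ->
  (forall x, x < stmt_vars st -> s.1 x = env x) -> (forall x, env x <= L) -> stmt_deg st <= D ->
  let s' := exec w (compile_stmt st t) s in
  s'.2 = run_stmt L nums st env s.2 /\ forall x, x < t -> s'.1 x = s.1 x.
Proof.
elim: st => [e|e st IH|x st IH|s1 IH1 s2 IH2] t s env.
- move=> /= ht he henv hd; have [v m r] := exec_compile_exp ht he henv hd.
  by rewrite v m.
- rewrite /= !geq_max => /andP[ht1 ht2] he henv /andP[d1 d2].
  have [v m r] := exec_compile_exp ht1 (fun x hx => he x (leq_trans hx (leq_maxl _ _))) henv d1.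
  rewrite v; case: eqP => _ /=; first by [].
  have := IH t (exec w (compile_exp e t) s) env ht2 _ henv d2.
  case=> [x hx|]; first by rewrite r ?he //; [exact: leq_trans hx (leq_maxr _ _) | lia].
  by rewrite m => -> r'; split=> // x hx; rewrite r' ?r.
- rewrite /= geq_max => /andP[xt ht] he henv d1.
  rewrite -/L; set s0 := (upd _ x 0, s.2); set f := fun s : state => _.
  have loop n : n <= L -> let s' := iter n f s0 in
    [/\ s'.2 = foldl (fun m v => run_stmt L nums st (upd env x v) m) s.2 (iota 0 n),
        s'.1 x = n, s'.1 t = s.1 x &
        forall y, y < t -> y != x -> s'.1 y = s.1 y].
    elim: n => [|n IHn] nL.
      by split=> //= [||y yt yx]; rewrite /upd; do ?case: eqP => //; lia.
    have := IHn (ltnW nL); rewrite iterS; set s1 := iter n f s0.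
    move=> [m1 x1 sv1 r1].
    have := IH t.+1 s1 (upd env x n) (leqW ht) _ _ d1.
    case=> [y hy|y|].
    + rewrite /upd; case: eqP => [->//|/eqP yx].
      by rewrite r1 ?he //; lia.
    + by rewrite /upd; case: eqP => _ //; exact: ltnW.
    have -> : iota 0 n.+1 = iota 0 n ++ [:: n] by rewrite -addn1 iotaD.
    rewrite foldl_cat /= -m1.
    set s2 := exec _ _ _ => m2 r2; split=> [|||y yt yx] //=.
    + by rewrite updE r2 ?x1 //; lia.
    + by rewrite updN ?r2 //; lia.
    + by rewrite updN // r2 ?r1 //; lia.
  have [m xv sv r] := loop L (leqnn L).
  split=> // y yt; rewrite /upd; case: eqP => [->//|/eqP yx]; exact: r.
- rewrite /= !geq_max => /andP[ht1 ht2] he henv /andP[d1 d2].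
  have [m r] := IH1 t s env ht1 (fun x hx => he x (leq_trans hx (leq_maxl _ _))) henv d1.
  have := IH2 t (exec w (compile_stmt s1 t) s) env ht2 _ henv d2.
  case=> [x hx|]; first by rewrite r ?he //; [exact: leq_trans hx (leq_maxr _ _) | lia].
  by rewrite m => -> r'; split=> // x hx; rewrite r' ?r.
Qed.

End Compile.

Theorem stmt_decides (st : stmt) (e : exp) :
  exists (M : TM) (c d : nat), wf_TM M /\
    (forall w, tm_halted M (tm_state_after M w (c * size w ^ d + c))) /\
    (forall nums, let w := enc_nats nums in 1 < size w ->
      tm_state_after M w (c * size w ^ d + c) = tm_acc M <->
      eval (size w) nums e (fun _ => 0)
        (run_stmt (size w) nums st (fun _ => 0) xpred0) <> 0).
Proof.
pose t := maxn (stmt_vars st) (exp_vars e); pose D := maxn (stmt_deg st) (arg_deg e).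
have [M [c [d [wfM [hM key]]]]] :=
  prog_decides (PSeq (compile_stmt D st t) (compile_exp D e t)) t.
exists M, c, d; split=> //; split=> // nums w hw; rewrite key /=.
have [m r] := exec_compile_stmt (s := (fun _ => 0, xpred0)) (env := fun _ => 0) erefl hw
  (leq_maxl _ _ : stmt_vars st <= t) (fun _ _ => erefl) (fun _ => leq0n _)
  (leq_maxl _ _ : _ <= D).
have [|v _ _] := exec_compile_exp (env := fun _ => 0) erefl hw
  (leq_maxr _ _ : exp_vars e <= t) _ (fun _ => leq0n _)
  (leq_maxr _ _ : _ <= D) (s := exec w (compile_stmt D st t) (fun _ => 0, xpred0)).
  by move=> x hx; rewrite r //; exact: leq_trans hx (leq_maxr _ _).
by rewrite v m.
Qed.

(** * Runs and strategies of sound acyclic negotiations *)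

Section Strategies.

Variable Ng : negotiation.
Hypothesis wfN : wf_negotiation Ng.
Hypothesis acyc : acyclic Ng.

Notation indom := (indom Ng). Notation inout := (inout Ng). Notation dlt := (dlt Ng).
Notation ninit := (ninit Ng). Notation nfin := (nfin Ng).
Notation is_node := (is_node Ng). Notation is_proc := (is_proc Ng).

Lemma indom_proc n p : indom n p -> is_proc p.
Proof. by case/and3P. Qed.

Lemma inout_node n a : inout n a -> is_node n.
Proof. by case/and3P. Qed.

Lemma init_node : is_node ninit. Proof. by case: wfN. Qed.
Lemma fin_node : is_node nfin. Proof. by case: wfN => _ []. Qed.

Lemma indom_ex n : is_node n -> exists p, indom n p.
Proof. by case: wfN => _ [_ [_ [_ [h _]]]]; exact: h. Qed.

Lemma inout_neq_fin n a : inout n a -> n <> nfin.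
Proof. by case: wfN => _ [_ [_ [_ [_ [h _]]]]] hn e; have := h a; rewrite -e hn. Qed.

Lemma dlt_dom n a p : inout n a -> indom n p -> is_node (dlt n a p) /\ indom (dlt n a p) p.
Proof. by case: wfN => _ [_ [_ [_ [_ [_ [_ h]]]]]]; exact: h. Qed.

Lemma edge_dlt n a p : inout n a -> indom n p -> edge Ng n (dlt n a p).
Proof. by move=> ha hp; exists a, p. Qed.

Lemma edge_nodes n n' : edge Ng n n' -> is_node n /\ is_node n'.
Proof. by case=> a [p [ha [hp <-]]]; split; [exact: inout_node ha | case: (dlt_dom ha hp)]. Qed.

Lemma path_plus_nodes n n' : path_plus Ng n n' -> is_node n /\ is_node n'.
Proof.
elim=> [x y /edge_nodes//|x y z /edge_nodes [hx _] _ [_ hz]].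
by split.
Qed.

Definition edge_ord (x y : 'I_(nnode Ng)) : bool :=
  [exists a : 'I_(nres Ng), exists p : 'I_(nproc Ng),
     [&& inout x a, indom x p & dlt x a p == y]].

Lemma edge_ordP (x y : 'I_(nnode Ng)) : reflect (edge Ng x y) (edge_ord x y).
Proof.
apply: (iffP existsP) => [[a /existsP [p /and3P [h1 h2 /eqP h3]]]|[a [p [h1 [h2 h3]]]]].
  by exists a, p.
have ha : a < nres Ng by case/and3P: h1.
have hp : p < nproc Ng by case/and3P: h2.
by exists (Ordinal ha); apply/existsP; exists (Ordinal hp); rewrite /= h1 h2 h3 eqxx.
Qed.

Lemma connect_edge_ord (x y : 'I_(nnode Ng)) : connect edge_ord x y -> x = y \/ path_plus Ng x y.
Proof.
case/connectP => s; elim: s x => [|z s IH] x /=; first by move=> _ ->; left.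
case/andP=> /edge_ordP hxz hs hy; right.
by case: (IH z hs hy) => [<-|hz]; [exact: pp_one | exact: pp_cons hxz hz].
Qed.

(** A height function that needs no recursion: along an edge the set of reachable nodes shrinks
    strictly, as acyclicity makes the source unreachable from the end of the edge. *)
Definition rank (n : nat) : nat :=
  if insub n is Some x then #|[pred y | connect edge_ord x y]| else 0.

Lemma rank_le n : rank n <= nnode Ng.
Proof. by rewrite /rank; case: insub => // x; rewrite -[X in _ <= X]card_ord max_card. Qed.

Lemma rank_edge n n' : edge Ng n n' -> rank n' < rank n.
Proof.
move=> e; have [hn hn'] := edge_nodes e.
rewrite /rank (insubT (fun i => i < nnode Ng) hn) (insubT (fun i => i < nnode Ng) hn') /=.
set x : 'I__ := Sub n hn; set y : 'I__ := Sub n' hn'.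
have xy : edge_ord x y by apply/edge_ordP.
apply: proper_card; apply/properP; split.
  by apply/subsetP => z; rewrite !inE => /(connect_trans (connect1 xy)).
exists x; rewrite inE ?connect0 //; apply/negP => /connect_edge_ord.
case=> [/(congr1 val) /= e'|h]; first by apply: (acyc (n := n)); rewrite -{2}e'; apply: pp_one.
by apply: (acyc (n := n)); apply: pp_cons e h.
Qed.

Lemma rank_path n n' : path_plus Ng n n' -> rank n' < rank n.
Proof.
elim=> [x y /rank_edge//|x y z /rank_edge h _ IH]; exact: ltn_trans IH h.
Qed.

Inductive sreach (sg : nat -> nat) : nat -> nat -> Prop :=
  | sreach0 x : sreach sg x x
  | sreachS x p y : x <> nfin -> indom x p -> sreach sg (dlt x (sg x) p) y -> sreach sg x y.

Lemma sreach_snoc sg x y p : sreach sg x y -> y <> nfin -> indom y p ->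
  sreach sg x (dlt y (sg y) p).
Proof.
elim=> [z hz hp|z q z' hz hq _ IH hz' hp]; first exact: sreachS hz hp (sreach0 _ _).
by apply: sreachS hz hq _; apply: IH.
Qed.

(** [nfin] is exempt from [B]: it has no results, so it occurs in no run. *)
Definition good_strategy (sg : nat -> nat) (P : seq (nat * nat)) (B : seq nat) : Prop :=
  (forall n, sreach sg ninit n -> n <> nfin -> inout n (sg n) /\ n \notin B) /\
  (forall x, x \in P -> [/\ x.1 <> nfin, sreach sg ninit x.1 & sg x.1 = x.2]).

(** * Runs of a deterministic negotiation as moves of process positions *)

Definition conf_of (pos : nat -> nat) : config := fun p m => m == pos p.

Definition fire (pos : nat -> nat) (n a p : nat) : nat :=
  if indom n p then dlt n a p else pos p.

Fixpoint pvalid (pos : nat -> nat) (s : seq (nat * nat)) : Prop :=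
  if s is (n, a) :: s' then
    [/\ forall p, indom n p -> pos p = n, inout n a & pvalid (fire pos n a) s']
  else True.

Fixpoint pfinal (pos : nat -> nat) (s : seq (nat * nat)) : nat -> nat :=
  if s is (n, a) :: s' then pfinal (fire pos n a) s' else pos.

Lemma conf_eq_sym C C' : conf_eq Ng C C' -> conf_eq Ng C' C.
Proof. by move=> h p hp m; rewrite h. Qed.

Lemma conf_eq_trans C1 C2 C3 : conf_eq Ng C1 C2 -> conf_eq Ng C2 C3 -> conf_eq Ng C1 C3.
Proof. by move=> h1 h2 p hp m; rewrite h1 // h2. Qed.

Lemma step_conf_eq C C1 na C' : conf_eq Ng C C1 -> step Ng C na C' -> step Ng C1 na C'.
Proof.
case: na => n a h [[hn he] ha hs]; split=> //.
  by split=> // p hp; rewrite -h ?he //; apply: indom_proc hp.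
by move=> p hp m; rewrite hs // h.
Qed.

Lemma run_conf_eq C C1 s C' : conf_eq Ng C C1 -> run Ng C s C' -> run Ng C1 s C'.
Proof.
case: s => [|na s] /=; first by move=> /conf_eq_sym; exact: conf_eq_trans.
by move=> h [C2 [hs hr]]; exists C2; split=> //; apply: step_conf_eq hs.
Qed.

Lemma run_cat C s1 C1 s2 C2 : run Ng C s1 C1 -> run Ng C1 s2 C2 -> run Ng C (s1 ++ s2) C2.
Proof.
elim: s1 C => [|na s1 IH] C /=; first by move=> /conf_eq_sym; exact: run_conf_eq.
by case=> C3 [h1 h2] h3; exists C3; split=> //; apply: IH.
Qed.

Lemma step_conf_of pos n a C : step Ng (conf_of pos) (n, a) C ->
  [/\ forall p, indom n p -> pos p = n, inout n a & conf_eq Ng C (conf_of (fire pos n a))].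
Proof.
case=> [[hn he] ha hs]; split=> // [p /he /eqP|p hp m] //.
by rewrite hs // /conf_of /fire; case: ifP.
Qed.

Lemma step_fire pos n a : is_node n -> (forall p, indom n p -> pos p = n) -> inout n a ->
  step Ng (conf_of pos) (n, a) (conf_of (fire pos n a)).
Proof.
move=> hn he ha; split=> //.
  by split=> // p /he; rewrite /conf_of => ->.
by move=> p _ m; rewrite /conf_of /fire; case: ifP.
Qed.

Lemma run_pvalid pos s C : run Ng (conf_of pos) s C ->
  pvalid pos s /\ conf_eq Ng (conf_of (pfinal pos s)) C.
Proof.
elim: s pos => [|[n a] s IH] pos //= [C1 [/step_conf_of [h1 h2 h3] hr]].
by have [h4 h5] := IH _ (run_conf_eq h3 hr).
Qed.

Lemma successful_pvalid s : successful Ng s ->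
  pvalid (fun _ => ninit) s /\ forall p, is_proc p -> pfinal (fun _ => ninit) s p = nfin.
Proof.
move=> h; have [h1 h2] : pvalid (fun _ => ninit) s /\
    conf_eq Ng (conf_of (pfinal (fun _ => ninit) s)) (Cfin Ng) by apply: run_pvalid.
split=> // p hp; apply/eqP.
by have := h2 p hp (pfinal (fun _ => ninit) s p); rewrite /conf_of /Cfin eqxx.
Qed.

Lemma pvalid_inout pos s x : pvalid pos s -> x \in s -> inout x.1 x.2.
Proof.
elim: s pos => [|[n a] s IH] pos //= [_ ha hv].
by rewrite inE => /orP [/eqP -> //|]; apply: IH hv.
Qed.

(** A process leaves its node only when that node is executed. *)
Lemma pvalid_executes pos s p : pvalid pos s -> pfinal pos s p = nfin -> is_proc p ->
  pos p = nfin \/ exists a, (pos p, a) \in s.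
Proof.
elim: s pos => [|[n a] s IH] pos /=; first by move=> _; left.
case=> he ha hv hf hp; case d: (indom n p).
  by right; exists a; rewrite he // mem_head.
have := IH _ hv hf hp; rewrite /fire d => -[|[b hb]]; first by left.
by right; exists b; rewrite inE hb orbT.
Qed.

Lemma pvalid_succ pos s x p : pvalid pos s -> (forall p, is_proc p -> pfinal pos s p = nfin) ->
  x \in s -> indom x.1 p -> dlt x.1 x.2 p = nfin \/ exists a, (dlt x.1 x.2 p, a) \in s.
Proof.
elim: s pos => [|[n a] s IH] pos //= [he ha hv] hf.
have lift m : m = nfin \/ (exists b, (m, b) \in s) ->
    m = nfin \/ exists b, (m, b) \in (n, a) :: s.
  by case=> [|[b hb]]; [left | right; exists b; rewrite inE hb orbT].
rewrite inE => /orP [/eqP -> /= hp|hx hp]; apply: lift; last exact: IH hv hf hx hp.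
have := pvalid_executes hv (hf p (indom_proc hp)) (indom_proc hp).
by rewrite /fire hp.
Qed.

Lemma pvalid_path pos s x p : pvalid pos s -> x \in s -> indom x.1 p ->
  pos p = x.1 \/ path_plus Ng (pos p) x.1.
Proof.
elim: s pos => [|[n a] s IH] pos //= [he ha hv].
rewrite inE => /orP [/eqP -> /= hp|hx hp]; first by left; apply: he.
have := IH _ hv hx hp; rewrite /fire; case: ifP => // d h; right.
rewrite he //; have e := edge_dlt ha d.
by case: h => [<-|h]; [exact: pp_one | exact: pp_cons e h].
Qed.

(** Once a node is executed, its processes stand on successors of it, so by [pvalid_path] a second
    execution would close a cycle. *)
Lemma pvalid_uniq pos s n a b : pvalid pos s -> (n, a) \in s -> (n, b) \in s -> a = b.
Proof.
have head m c s' pos' d : (forall p, indom m p -> pos' p = m) -> inout m c ->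
    pvalid (fire pos' m c) s' -> (m, d) \in s' -> False.
  move=> he hc hv hd; have [p hp] := indom_ex (inout_node hc).
  have := pvalid_path hv hd hp; rewrite /fire /= hp => h.
  apply: (acyc (n := m)); have e := edge_dlt hc hp.
  by case: h => h; [rewrite h in e; exact: pp_one | exact: pp_cons e h].
elim: s pos => [|[m c] s IH] pos //= [he hc hv].
rewrite !inE => /orP [/eqP [e1 e2]|ha] /orP [/eqP [e3 e4]|hb].
- by rewrite e2 e4.
- by rewrite e1 in hb; case: (head _ _ _ _ _ he hc hv hb).
- by rewrite e3 in ha; case: (head _ _ _ _ _ he hc hv ha).
- exact: IH hv ha hb.
Qed.

Lemma pvalid_sreach sg pos s x : pvalid pos s ->
  (forall p, is_proc p -> sreach sg ninit (pos p)) ->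
  (forall y, y \in s -> sg y.1 = y.2) -> x \in s -> sreach sg ninit x.1.
Proof.
elim: s pos => [|[n a] s IH] pos //= [he ha hv] hpos hsg.
have [p hp] := indom_ex (inout_node ha).
have hn : sreach sg ninit n by rewrite -(he p hp); apply: hpos; apply: indom_proc hp.
rewrite inE => /orP [/eqP -> //|]; apply: IH hv _ _ => [q hq|y hy].
  rewrite /fire; case: ifP => d; last exact: hpos.
  have <- : sg n = a by exact: (hsg (n, a) (mem_head _ _)).
  by apply: sreach_snoc => //; apply: inout_neq_fin ha.
by apply: hsg; rewrite inE hy orbT.
Qed.

(** Every process of an executed node has to go on to [nfin], so each successor it is sent to is
    executed as well. With [pvalid_sreach], a successful run that follows [sg] executes exactly the
    nodes other than [nfin] that [sg] reaches. *)
Lemma sreach_executed sg s n : successful Ng s -> (forall y, y \in s -> sg y.1 = y.2) ->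
  sreach sg ninit n -> n <> nfin -> (n, sg n) \in s.
Proof.
move=> /successful_pvalid [hv hf] hsg.
have fix_sg m : m = nfin \/ (exists a, (m, a) \in s) -> m = nfin \/ (m, sg m) \in s.
  by case=> [|[a ha]]; [left | right; rewrite (hsg _ ha)].
have go x y : sreach sg x y -> x = nfin \/ (x, sg x) \in s -> y = nfin \/ (y, sg y) \in s.
  elim=> [//|z p y' hz hp _ IH] [//|hzs]; apply: IH; apply: fix_sg.
  exact: pvalid_succ hv hf hzs hp.
move=> hr hn; have [p hp] := indom_ex init_node.
have h0 := pvalid_executes hv (hf p (indom_proc hp)) (indom_proc hp).
by case: (go _ _ hr (fix_sg _ h0)).
Qed.

Lemma run_strategy P B : has_run_incl_omit Ng P B -> exists sg, good_strategy sg P B.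
Proof.
case=> s [hs [hP hB]]; have [hv hf] := successful_pvalid hs.
(* The result at the first occurrence of [n]; by [pvalid_uniq] all occurrences agree. *)
pose sg n := (nth (0, 0) s (find (fun x => x.1 == n) s)).2.
have hsg y : y \in s -> sg y.1 = y.2.
  move=> ys; have h : has (fun x => x.1 == y.1) s by apply/hasP; exists y.
  apply: (pvalid_uniq hv (n := y.1)); last by case: y ys {h}.
  have := nth_find (0, 0) h; rewrite has_find in h.
  have := mem_nth (0, 0) h; rewrite /sg.
  by case: (nth _ _ _) => u v /= hm /eqP <-.
exists sg; split=> [n hr hn|x xP].
  have h := sreach_executed hs hsg hr hn.
  by split; [exact: pvalid_inout hv h | exact: (hB _ h)].
have xs := hP _ xP; split; last exact: hsg.
- exact: inout_neq_fin (pvalid_inout hv xs).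
- by apply: pvalid_sreach hv _ hsg xs => p _; apply: sreach0.
Qed.

Hypothesis snd : sound Ng.

(** Soundness extends the current run to a successful one. If the extension is nonempty, its first
    node is enabled; firing it with the result of [sg], in place of the one in the extension, keeps
    the run on the strategy and lowers the sum of the ranks of the positions. *)
Lemma strategy_run_exists sg : (forall n, sreach sg ninit n -> n <> nfin -> inout n (sg n)) ->
  exists s, successful Ng s /\ forall x, x \in s -> sreach sg ninit x.1 /\ sg x.1 = x.2.
Proof.
move=> hsg.
suff extend m (pos : nat -> nat) s0 : \sum_(p < nproc Ng) rank (pos p) <= m ->
    run Ng (Cinit Ng) s0 (conf_of pos) -> (forall p, is_proc p -> sreach sg ninit (pos p)) ->
    (forall x, x \in s0 -> sreach sg ninit x.1 /\ sg x.1 = x.2) ->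
    exists s, successful Ng s /\ forall x, x \in s -> sreach sg ninit x.1 /\ sg x.1 = x.2.
  by apply: (extend _ (fun _ => ninit) [::] (leqnn _)) => // p _; apply: sreach0.
elim: m pos s0 => [|m IH] pos s0 hm hr hpos hs0.
all: have [[|[n a] s] hs] := snd hr; first by
  exists s0; split=> //; rewrite -[s0]cats0; apply: run_cat hr hs.
all: have [C [/step_conf_of [he ha _] _]] := hs.
all: have [p hp] := indom_ex (inout_node ha); have hp' := indom_proc hp.
all: have hn := inout_neq_fin ha.
all: have rn : sreach sg ninit n by rewrite -(he p hp); apply: hpos.
all: have hin := hsg n rn hn.
all: have lt : \sum_(q < nproc Ng) rank (fire pos n (sg n) q) <
    \sum_(q < nproc Ng) rank (pos q)
  by rewrite (bigD1 (Ordinal hp')) //= [X in _ < X](bigD1 (Ordinal hp')) //= -addSn;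
  apply: leq_add; [rewrite /fire hp he //; apply: rank_edge; apply: edge_dlt |
    apply: leq_sum => q _; rewrite /fire; case: ifP => // d;
    rewrite he //; apply: ltnW; apply: rank_edge; apply: edge_dlt].
  by move: (leq_trans lt hm).
apply: (IH (fire pos n (sg n)) (rcons s0 (n, sg n))).
- by rewrite -ltnS; apply: leq_trans lt hm.
- rewrite -cats1; apply: run_cat hr _.
  exists (conf_of (fire pos n (sg n))); split=> //.
  exact: step_fire (inout_node ha) he hin.
- move=> q hq; rewrite /fire; case: ifP => d; last exact: hpos.
  exact: sreach_snoc.
- by move=> x; rewrite mem_rcons inE => /orP [/eqP ->|/hs0].
Qed.

Theorem run_iff_strategy P B :
  has_run_incl_omit Ng P B <-> exists sg, good_strategy sg P B.
Proof.
split; first exact: run_strategy.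
case=> sg [h1 h2].
have [s [hs hsx]] := strategy_run_exists (fun n hr hn => proj1 (h1 n hr hn)).
exists s; split=> //; split=> [x xP|x xs].
  have [hx hr hsg] := h2 _ xP.
  have := sreach_executed hs (fun y ys => proj2 (hsx y ys)) hr hx.
  by rewrite hsg; case: x {xP hx hr hsg}.
have [hr _] := hsx _ xs; have [hv _] := successful_pvalid hs.
by have [] := h1 _ hr (inout_neq_fin (pvalid_inout hv xs)).
Qed.

End Strategies.

(** * Tokens *)

Section Tokens.

Variable Ng : negotiation.
Hypothesis wfN : wf_negotiation Ng.
Hypothesis acyc : acyclic Ng.
Hypothesis snd : sound Ng.
Variables (P : seq (nat * nat)) (B : seq nat) (K : nat).

Notation indom := (indom Ng). Notation inout := (inout Ng). Notation dlt := (dlt Ng).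
Notation ninit := (ninit Ng). Notation nfin := (nfin Ng).
Notation is_node := (is_node Ng). Notation is_proc := (is_proc Ng).

Definition allowed (n a : nat) : Prop :=
  [/\ inout n a, n \notin B & forall x, x \in P -> x.1 = n -> x.2 = a].

(** And-or reachability: one result is chosen, and the successors for all processes of the node must
    win. [nfin] wins even if it lies in [B], because it is never executed. *)
Inductive Win : nat -> Prop :=
  | WinFin : Win nfin
  | WinStep n a : allowed n a -> (forall p, indom n p -> Win (dlt n a p)) -> Win n.

Definition winning_result (n a : nat) : Prop :=
  allowed n a /\ forall p, indom n p -> Win (dlt n a p).

(* Token [j] has to travel from [x j] to [t j]; all tokens follow the same strategy. *)
Definition joint_paths (t x : nat -> nat) : Prop :=
  exists sg, (forall n, Win n -> n <> nfin -> winning_result n (sg n)) /\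
    forall j, j < K -> sreach Ng sg (x j) (t j).

(* All travelling tokens located at [n] move at once, and no travelling token
   may still come back to [n]: this makes the choice of [a] at [n] unique. *)
Definition legal_move (t x : nat -> nat) (n a : nat) (p : nat -> nat) : Prop :=
  winning_result n a /\
  forall j, j < K -> indom n (p j) /\ (x j <> t j -> ~ path_plus Ng (x j) n).

Definition moved (t x : nat -> nat) (n a : nat) (p : nat -> nat) (j : nat) : nat :=
  if (x j == n) && (x j != t j) then dlt n a (p j) else x j.

Lemma win_result n : Win n -> n <> nfin -> exists a, winning_result n a.
Proof. by case=> // m a h1 h2 _; exists a. Qed.

Lemma sreach_winning sg x y : (forall n, Win n -> n <> nfin -> winning_result n (sg n)) ->
  sreach Ng sg x y -> Win x -> Win y.
Proof.
move=> hsg; elim=> // z p z' hz hp _ IH wz; apply: IH.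
by case: (hsg z wz hz) => _; apply.
Qed.

Lemma sreach_first sg x y : sreach Ng sg x y ->
  x = y \/ x <> nfin /\ exists2 p, indom x p & sreach Ng sg (dlt x (sg x) p) y.
Proof.
by case=> [z|z p z' hz hp hr]; [left | right; split=> //; exists p].
Qed.

Lemma winning_strategy : exists sg, forall n, Win n -> n <> nfin -> winning_result n (sg n).
Proof.
apply: (functional_choice (fun n a => Win n -> n <> nfin -> winning_result n a)) => n.
case: (classic (Win n /\ n <> nfin)) => [[h1 h2]|h]; last by exists 0 => h1 h2; case: h.
by case: (win_result h1 h2) => a ha; exists a.
Qed.

Lemma joint_paths_done t x : (forall j, j < K -> x j = t j) -> joint_paths t x.
Proof.
move=> h; have [sg hsg] := winning_strategy; exists sg; split=> // j hj.
by rewrite h //; apply: sreach0.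
Qed.

(** Changing the strategy to [a] at [n] harms no path: a token that leaves [n] cannot return by
    acyclicity, and the other travelling tokens cannot reach [n] by legality. *)
Lemma joint_paths_move t x n a p : n <> nfin -> (forall j, j < K -> Win (x j)) ->
  legal_move t x n a p -> joint_paths t (moved t x n a p) -> joint_paths t x.
Proof.
move=> hn wx [hna hp] [sg [hsg hs]].
pose sg' m := if m == n then a else sg m.
have avoid y z : sreach Ng sg y z -> Win y -> y <> n -> ~ path_plus Ng y n ->
    sreach Ng sg' y z.
  elim=> [u|u q u' hu hq hr IH] wu un up; first exact: sreach0.
  have [[hin _ _] hw] := hsg u wu hu; have e := edge_dlt hin hq.
  have eu : sg' u = sg u by rewrite /sg'; case: eqP.
  apply: (sreachS hu hq); rewrite eu; apply: IH; first exact: hw.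
    by move=> h; apply: up; rewrite -h; apply: pp_one.
  by move=> h; apply: up; apply: pp_cons e h.
exists sg'; split=> [m wm hm|j hj].
  by rewrite /sg'; case: eqP => [->|_] //; apply: hsg.
case: (x j =P t j) => [->|xt]; first exact: sreach0.
have [hpj np] := hp j hj; have := hs j hj; rewrite /moved.
have -> /= : x j != t j by apply/eqP.
rewrite andbT; case: eqP => [xn|xn] hr; last first.
  by apply: avoid hr (wx j hj) xn (np xt).
have e := edge_dlt (let: conj (And3 h _ _) _ := hna in h) hpj.
have en : sg' n = a by rewrite /sg' eqxx.
rewrite xn; apply: (sreachS hn hpj); rewrite en; apply: avoid hr _ _ _.
- by case: hna => _; apply.
- by move=> h; apply: (acyc (n := n)); rewrite -{2}h; apply: pp_one.
- by move=> h; apply: (acyc (n := n)); apply: pp_cons e h.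
Qed.

Definition total_rank (x : nat -> nat) : nat := \sum_(j < K) rank Ng (x j).

Lemma joint_paths_unfold t x : (forall j, j < K -> Win (x j)) -> joint_paths t x ->
  (forall j, j < K -> x j = t j) \/
  exists n a p, [/\ n <> nfin, legal_move t x n a p, joint_paths t (moved t x n a p),
    forall j, j < K -> Win (moved t x n a p j) & total_rank (moved t x n a p) < total_rank x].
Proof.
move=> wx [sg [hsg hs]].
case: (boolP [forall j : 'I_K, x j == t j]) => [/forallP h|].
  by left=> j hj; apply/eqP: (h (Ordinal hj)).
rewrite negb_forall => /existsP [j0 hj0]; right.
(* A travelling token of maximal rank: paths lower the rank, so no travelling token can still come
   to its node. *)
case: (arg_maxnP (P := fun j : 'I_K => x j != t j) (fun j => rank Ng (x j)) hj0) => j /eqP hj hmax.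
set n := x j; exists n, (sg n).
have split_path i : i < K -> x i = n -> x i <> t i ->
    n <> nfin /\ exists2 p, indom n p & sreach Ng sg (dlt n (sg n) p) (t i).
  by move=> hi <- ne; case: (sreach_first (hs i hi)).
have [hn [p0 hp0 _]] := split_path j (ltn_ord j) erefl hj.
have wr := hsg n (wx j (ltn_ord j)) hn.
have [p hp] : exists p : nat -> nat, forall i, indom n (p i) /\
    (i < K -> x i = n -> x i <> t i -> sreach Ng sg (dlt n (sg n) (p i)) (t i)).
  apply: (functional_choice (fun i q => indom n q /\
    (i < K -> x i = n -> x i <> t i -> sreach Ng sg (dlt n (sg n) q) (t i)))) => i.
  case: (boolP [&& i < K, x i == n & x i != t i]) => [/and3P [h1 /eqP h2 /eqP h3]|h].
    by have [_ [q h4 h5]] := split_path i h1 h2 h3; exists q.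
  (* [legal_move] asks for a process of [n] even for tokens that do not move; any one serves. *)
  exists p0; split=> // h1 h2 /eqP h3; move: h; by rewrite h1 h2 eqxx -h2 h3.
exists p; have lm : legal_move t x n (sg n) p.
  split=> // i hi; split=> [|/eqP xt hpath]; first by case: (hp i).
  have := hmax (Ordinal hi) xt; rewrite /= leqNgt => /negP; apply.
  exact: rank_path hpath.
split=> //.
- exists sg; split=> // i hi; rewrite /moved; case: ifP => [/andP [/eqP h1 /eqP h2]|_].
    by case: (hp i) => _; apply.
  exact: hs.
- move=> i hi; rewrite /moved; case: ifP => _; last exact: wx.
  by case: wr => _; apply; case: (hp i).
- have hr i : rank Ng (moved t x n (sg n) p i) <= rank Ng (x i).
    rewrite /moved; case: ifP => // /andP [/eqP -> _].
    apply: ltnW; apply: rank_edge => //; apply: edge_dlt; first by case: wr => [[]].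
    by case: (hp i).
  rewrite /total_rank (bigD1 j) //= [X in _ < X](bigD1 j) //= -addSn.
  apply: leq_add; last by apply: leq_sum.
  rewrite /moved eqxx; move/eqP: hj => /= ->.
  apply: rank_edge => //; apply: edge_dlt; first by case: wr => [[]].
  by case: (hp j).
Qed.

Lemma good_strategy_win sg n : good_strategy Ng sg P B -> sreach Ng sg ninit n -> Win n.
Proof.
case=> h1 h2; have [m hm] := ubnP (rank Ng n); elim: m n hm => // m IH n hm hr.
case: (n =P nfin) => [->|hn]; first exact: WinFin.
have [hin hB] := h1 n hr hn; apply: (WinStep (a := sg n)).
  by split=> // x xP e; case: (h2 x xP) => _ _; rewrite e.
move=> p hp; apply: IH; last exact: sreach_snoc.
by apply: leq_trans (rank_edge wfN acyc (edge_dlt hin hp)) _.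
Qed.

Hypothesis P_size : size (undup P) <= K.
Hypothesis P_nodes : forall x, x \in P -> is_node x.1.

Theorem run_iff_tokens : has_run_incl_omit Ng P B <->
  Win ninit /\ exists t : nat -> nat, [/\ forall j, j < K -> is_node (t j),
    forall x, x \in P -> x.1 <> nfin /\ exists2 j, j < K & t j = x.1 &
    joint_paths t (fun _ => ninit)].
Proof.
apply: (iff_trans (run_iff_strategy wfN acyc snd P B)); split.
  case=> sg good; have [h1 h2] := good.
  split; first exact: good_strategy_win good (sreach0 _ _ _).
  pose ns := undup (map fst P).
  have ns_mem n : n \in ns -> exists2 x, x \in P & n = x.1.
    by rewrite mem_undup => /mapP.
  have ns_size : size ns <= K.
    apply: leq_trans P_size; rewrite -(size_map fst).
    apply: uniq_leq_size (undup_uniq _) _ => n; rewrite mem_undup => /mapP [x xP ->].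
    by rewrite map_f // mem_undup.
  have t_mem j : nth ninit ns j = ninit \/ nth ninit ns j \in ns.
    by case: (ltnP j (size ns)) => hj; [right; apply: mem_nth | left; apply: nth_default].
  (* Surplus tokens get the target [ninit], where they already are. *)
  exists (nth ninit ns); split=> [j _|x xP|].
  - case: (t_mem j) => [->|/ns_mem [x xP ->]]; [exact: init_node | exact: P_nodes].
  - have [hx _ _] := h2 x xP; split=> //.
    have hx' : x.1 \in ns by rewrite mem_undup map_f.
    by exists (index x.1 ns); [apply: leq_trans ns_size; rewrite index_mem | apply: nth_index].
  (* [joint_paths] asks for winning results on all of [Win], whereas [sg] is controlled only on the
     nodes it reaches; elsewhere it is replaced by a winning strategy. *)
  - have [sg' hsg'] : exists sg', forall n, (sreach Ng sg ninit n -> sg' n = sg n) /\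
        (Win n -> n <> nfin -> winning_result n (sg' n)).
      apply: (functional_choice (fun n a => (sreach Ng sg ninit n -> a = sg n) /\
        (Win n -> n <> nfin -> winning_result n a))) => n.
      case: (classic (sreach Ng sg ninit n)) => hr.
        exists (sg n); split=> // wn hn; have [hin hB] := h1 n hr hn; split.
          by split=> // x xP e; case: (h2 x xP) => _ _; rewrite e.
        by move=> p hp; apply: good_strategy_win good _; apply: sreach_snoc.
      have [sg0 h0] := winning_strategy.
      by exists (sg0 n); split=> //; apply: h0.
    exists sg'; split=> [n|j hj]; first by case: (hsg' n).
    have same y z : sreach Ng sg y z -> sreach Ng sg ninit y -> sreach Ng sg' y z.
      elim=> [u|u p u' hu hp _ IH] hr; first exact: sreach0.
      apply: (sreachS hu hp); case: (hsg' u) => -> // _; apply: IH.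
      exact: sreach_snoc.
    apply: same; last exact: sreach0.
    case: (t_mem j) => [->|/ns_mem [x xP ->]]; first exact: sreach0.
    by case: (h2 x xP).
case=> winit [t [tn hP [sg [hsg hs]]]]; exists sg; split=> [n hr hn|x xP].
  have [[hin hB _] _] := hsg n (sreach_winning hsg hr winit) hn.
  by split.
have [hx [j hj e]] := hP x xP; have := hs j hj; rewrite e => hr; split=> //.
have [[_ _ h] _] := hsg x.1 (sreach_winning hsg hr winit) hx.
by rewrite (h x xP).
Qed.

End Tokens.

(** * Formulas over the encoded instance *)

Definition Not (e : exp) : exp := Eq e (Cst 0).
Definition Imp (e1 e2 : exp) : exp := Add (Not e1) e2.
Definition All (x : nat) (e : exp) : exp := Not (Ex x (Not e)).
Definition Conj (es : seq exp) : exp := foldr Mul (Cst 1) es.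
Definition Disj (es : seq exp) : exp := foldr Add (Cst 0) es.
Definition Exs (xs : seq nat) (e : exp) : exp := foldr Ex e xs.
Definition Fors (xs : seq nat) (s : stmt) : stmt := foldr For s xs.
(* Variable 5 must not occur in [e1] and [e2]. *)
Definition Lt (e1 e2 : exp) : exp := Ex 5 (Eq (Add (Add e1 (Var 5)) (Cst 1)) e2).

(** The assignments that nested loops or quantifiers over [xs] can produce when started from
    [env]. *)
Definition agree_off (xs : seq nat) (L : nat) (env env' : nat -> nat) : Prop :=
  (forall y, y \notin xs -> env' y = env y) /\ (forall y, y \in xs -> env' y < L).

Lemma agree_off_cons x xs L env env' :
  agree_off (x :: xs) L env env' -> env' x < L /\ agree_off xs L (upd env x (env' x)) env'.
Proof.
case=> h1 h2; split; first by apply: h2; rewrite mem_head.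
split=> y hy; last by apply: h2; rewrite inE hy orbT.
by rewrite /upd; case: eqP => [->//|/eqP ne]; apply: h1; rewrite inE negb_or ne.
Qed.

Lemma agree_off_upd x xs L env env' v : v < L ->
  agree_off xs L (upd env x v) env' -> agree_off (x :: xs) L env env'.
Proof.
move=> hv [h1 h2]; split=> y; rewrite inE.
  by rewrite negb_or => /andP [ne hy]; rewrite h1 // updN.
case: (boolP (y \in xs)) => [hy _|hy]; first exact: h2.
by rewrite orbF => /eqP e; rewrite h1 // e updE.
Qed.

Section Truth.

Variables (L : nat) (nums : seq nat).

Definition holds (e : exp) (env : nat -> nat) (m : nat -> bool) : Prop :=
  eval L nums e env m <> 0.

Lemma holds_mul env m e1 e2 : holds (Mul e1 e2) env m <-> holds e1 env m /\ holds e2 env m.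
Proof. by rewrite /holds /=; nia. Qed.

Lemma holds_add env m e1 e2 : holds (Add e1 e2) env m <-> holds e1 env m \/ holds e2 env m.
Proof. by rewrite /holds /=; lia. Qed.

Lemma holds_eq env m e1 e2 : holds (Eq e1 e2) env m <-> eval L nums e1 env m = eval L nums e2 env m.
Proof. by rewrite /holds /=; case: eqP. Qed.

Lemma holds_not env m e : holds (Not e) env m <-> ~ holds e env m.
Proof. by rewrite /holds /=; lia. Qed.

Lemma holds_imp env m e1 e2 : holds (Imp e1 e2) env m <-> (holds e1 env m -> holds e2 env m).
Proof. by rewrite /holds /=; lia. Qed.

Lemma holds_tab env m e : holds (Tab e) env m <-> m (eval L nums e env m).
Proof. by rewrite /holds /=; case: (m _). Qed.

Lemma holds_ex env m x e : holds (Ex x e) env m <-> exists2 v, v < L & holds e (upd env x v) m.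
Proof.
rewrite /holds /=; split.
  case: hasP => // -[v]; rewrite mem_iota => /= hv /eqP he _; by exists v.
by case=> v hv /eqP he; case: hasP => // -[]; exists v; rewrite ?mem_iota.
Qed.

Lemma holds_all env m x e : holds (All x e) env m <-> forall v, v < L -> holds e (upd env x v) m.
Proof.
rewrite /holds /=; split.
  case: hasP => // h _ v hv; apply/eqP; apply: contraT; rewrite negbK => he.
  by case: h; exists v; rewrite ?mem_iota // (eqP he).
move=> h; case: hasP => // -[v]; rewrite mem_iota => /= hv.
by have /eqP := h v hv; case: eval.
Qed.

(** The bound [L] on the second value keeps the difference, which is the witness, in the range of
    [Ex]. *)
Lemma holds_lt env m e1 e2 : (forall v, eval L nums e1 (upd env 5 v) m = eval L nums e1 env m) ->
  (forall v, eval L nums e2 (upd env 5 v) m = eval L nums e2 env m) ->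
  eval L nums e2 env m <= L ->
  holds (Lt e1 e2) env m <-> eval L nums e1 env m < eval L nums e2 env m.
Proof.
move=> h1 h2 hL; rewrite holds_ex; split.
  by case=> v _; rewrite holds_eq /= h1 h2 updE; lia.
move=> lt; exists (eval L nums e2 env m - (eval L nums e1 env m).+1); first by lia.
by rewrite holds_eq /= h1 h2 updE; lia.
Qed.

Lemma holds_conj env m (T : eqType) (F : T -> exp) s :
  holds (Conj (map F s)) env m <-> forall j, j \in s -> holds (F j) env m.
Proof.
elim: s => [|i s IH] //=; rewrite holds_mul IH; split.
  by case=> h1 h2 j; rewrite inE => /orP [/eqP ->|/h2].
by move=> h; split=> [|j hj]; apply: h; rewrite inE ?eqxx ?hj ?orbT.
Qed.

Lemma holds_disj env m (T : eqType) (F : T -> exp) s :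
  holds (Disj (map F s)) env m <-> exists2 j, j \in s & holds (F j) env m.
Proof.
elim: s => [|i s IH] /=; first by split=> [|[]].
rewrite holds_add IH; split.
  by case=> [h|[j hj h]]; [exists i | exists j]; rewrite // inE ?eqxx ?hj ?orbT.
by case=> j; rewrite inE => /orP [/eqP ->|hj] h; [left | right; exists j].
Qed.

End Truth.

Lemma holds_exs L nums xs e env m : holds L nums (Exs xs e) env m <->
  exists2 env', agree_off xs L env env' & holds L nums e env' m.
Proof.
elim: xs env => [|x xs IH] env /=.
  split=> [h|[env' [h1 _]]]; first by exists env.
  by have -> : env' = env by apply: functional_extensionality => y; apply: h1.
rewrite holds_ex; split.
  by case=> v hv /IH [env' h1 h2]; exists env' => //; apply: agree_off_upd h1.
case=> env' /agree_off_cons [h1 h2] h3; exists (env' x) => //; rewrite IH.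
by exists env'.
Qed.

(** * Rules that fill a table *)

Definition mem_le (m m' : nat -> bool) : Prop := forall ad, m ad -> m' ad.

Section Rules.

Variables (L : nat) (nums : seq nat).

Lemma run_stmt_le s env m : mem_le m (run_stmt L nums s env m).
Proof.
elim: s env m => [e|e s IH|x s IH|s1 IH1 s2 IH2] env m ad h /=.
- by rewrite /upd; case: eqP.
- by case: eqP => // _; apply: IH.
- by elim: (iota 0 L) m h => //= v vs IHv m h; apply: IHv; apply: IH.
- by apply: IH2; apply: IH1.
Qed.

Variables (Inv : (nat -> bool) -> Prop) (c e : exp).

Definition rule (xs : seq nat) : stmt := Fors xs (When c (SetTab e)).

Hypothesis Inv_rule : forall env m, Inv m -> holds L nums c env m ->
  Inv (upd m (eval L nums e env m) true).

Lemma rule_inv xs env m : Inv m -> Inv (run_stmt L nums (rule xs) env m).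
Proof.
elim: xs env m => [|x xs IH] env m h /=.
  by case: eqP => // /eqP/eqP hc; apply: Inv_rule.
by elim: (iota 0 L) m h => //= v vs IHv m h; apply: IHv; apply: IH.
Qed.

(** Other instances of the rule may add entries before the loops arrive at [env']. Since conditions
    may contain negated lookups, they need not persist when the table grows; hence they are required
    of every table above [m] that satisfies the invariant. *)
Lemma rule_complete xs env m env' ad : Inv m -> agree_off xs L env env' ->
  (forall m', Inv m' -> mem_le m m' -> holds L nums c env' m' /\ eval L nums e env' m' = ad) ->
  run_stmt L nums (rule xs) env m ad.
Proof.
elim: xs env m => [|x xs IH] env m hm.
  case=> h1 _ hc; have {}h1 : env' = env by apply: functional_extensionality => y; apply: h1.
  have [hc1 he] := hc m hm (fun _ h => h); rewrite h1 in hc1 he.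
  by rewrite /=; case: eqP => // _; rewrite he updE.
case/agree_off_cons=> hx ha hc /=.
have : env' x \in iota 0 L by rewrite mem_iota.
elim: (iota 0 L) m hm hc => //= v vs IHv m hm hc.
have le := @run_stmt_le (rule xs) (upd env x v) m.
rewrite inE; case: (env' x =P v) => [e'|_] /=.
  move=> _; have h : run_stmt L nums (rule xs) (upd env x v) m ad.
    by apply: IH => //; rewrite -e'.
  elim: vs (run_stmt _ _ _ _ m) h {IHv le} => //= v' vs IHv' m' h; apply: IHv'.
  exact: run_stmt_le.
apply: IHv; first exact: rule_inv.
by move=> m' hm' hle; apply: hc => // a ha'; apply: hle; apply: le.
Qed.

End Rules.

(** Variable 6 is a dummy: [k] nested loops over it serve only to repeat [s], [L ^ k] times. *)
Lemma rounds L nums (R : nat -> (nat -> bool) -> Prop) s k i env m :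
  (forall env m i, R i m -> R i.+1 (run_stmt L nums s env m)) -> R i m ->
  R (i + L ^ k) (run_stmt L nums (Fors (nseq k 6) s) env m).
Proof.
move=> hs; elim: k i env m => [|k IH] i env m h /=; first by rewrite addn1; apply: hs.
rewrite expnS -[X in X * _](size_iota 0 L).
elim: (iota 0 L) i m h => [|v vs IHv] i m h /=; first by rewrite mul0n addn0.
by rewrite mulSn addnA; apply: IHv; apply: IH.
Qed.

(** * Table addresses: base-b numerals with a tag *)

Definition code (b : nat) (vs : seq nat) : nat := foldr (fun v acc => v + b * acc) 0 vs.
(* Tag 0 is for the reachability table, 1 for [Win] and 2 for the token tuples. *)
Definition addr (b tag : nat) (vs : seq nat) : nat := 3 * code b vs + tag.

Lemma code_inj b vs vs' : size vs = size vs' -> all (fun v => v < b) vs ->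
  all (fun v => v < b) vs' -> code b vs = code b vs' -> vs = vs'.
Proof.
elim: vs vs' => [|v vs IH] [|v' vs'] //= [sz] /andP [h1 h2] /andP [h3 h4] e.
have ev : v = v'.
  have := congr1 (modn^~ b) e; rewrite /= ![_ + b * _]addnC ![b * _]mulnC !modnMDl.
  by rewrite !modn_small.
rewrite ev; congr (_ :: _); apply: IH => //.
move: e; rewrite ev => /addnI /eqP; rewrite eqn_pmul2l; last by lia.
by move/eqP.
Qed.

Lemma addr_inj b tag tag' vs vs' : tag < 3 -> tag' < 3 ->
  addr b tag vs = addr b tag' vs' ->
  tag = tag' /\ (size vs = size vs' -> all (fun v => v < b) vs ->
    all (fun v => v < b) vs' -> vs = vs').
Proof.
move=> h1 h2 e; have [e1 e2] : code b vs = code b vs' /\ tag = tag' by rewrite /addr in e; lia.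
by split=> // sz h3 h4; apply: code_inj e1.
Qed.

(** * Positions of the instance data among the encoded numbers *)

Section Lookup.

Variables (T : Type) (x0 : T) (F : T -> seq nat) (c : nat).
Hypothesis F_size : forall x, size (F x) = c.

Lemma size_flatten_map s : size (flatten (map F s)) = size s * c.
Proof. by elim: s => //= x s IH; rewrite size_cat F_size IH mulSn. Qed.

Lemma nth_flatten_map s i k : i < size s -> k < c ->
  nth 0 (flatten (map F s)) (i * c + k) = nth 0 (F (nth x0 s i)) k.
Proof.
elim: s i => [|x s IH] [|i] //= hi hk; rewrite nth_cat F_size.
  by rewrite mul0n add0n hk.
by rewrite mulSn -addnA ltnNge leq_addr /= addKn IH.
Qed.

End Lookup.

Lemma nth_cat_skip (s1 s2 : seq nat) n k : size s1 = n -> nth 0 (s1 ++ s2) (n + k) = nth 0 s2 k.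
Proof. by move=> <-; rewrite nth_cat ltnNge leq_addr /= addKn. Qed.

Lemma nth_cat_head (s1 s2 : seq nat) n k : size s1 = n -> k < n -> nth 0 (s1 ++ s2) k = nth 0 s1 k.
Proof. by move=> <- hk; rewrite nth_cat hk. Qed.

(** A number [k] takes [k.+1] symbols. Strictness makes every node, process, result and list index
    of an instance a value in the range of loops and quantifiers. *)
Lemma num_lt_size nums j : 0 < size nums -> nth 0 nums j < size (enc_nats nums).
Proof.
elim: nums j => [|k r IH] // j _.
rewrite /enc_nats /= size_cat /enc_nat size_cat size_nseq addn1 -/(enc_nats r).
case: j => [|j] /=; first by lia.
case: r IH => [|k' r] IH; first by rewrite nth_nil; lia.
by have := IH j isT; lia.
Qed.

(** The list encoded by [enc_instance], which is [enc_nats] of it by conversion. *)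
Definition instance_nums (Ng : negotiation) (P : seq (nat * nat)) (B : seq nat) : seq nat :=
  let nn := nnode Ng in let np := nproc Ng in let nr := nres Ng in
  [:: np; nn; nr; ninit Ng; nfin Ng]
  ++ flatten [seq [seq nat_of_bool (indom Ng n p) | p <- iota 0 np] | n <- iota 0 nn]
  ++ flatten [seq [seq nat_of_bool (inout Ng n a) | a <- iota 0 nr] | n <- iota 0 nn]
  ++ flatten [seq flatten [seq
        [seq (if inout Ng n a && indom Ng n p then dlt Ng n a p else 0)
           | p <- iota 0 np] | a <- iota 0 nr] | n <- iota 0 nn]
  ++ [:: size P] ++ flatten [seq [:: x.1; x.2] | x <- P]
  ++ [:: size B] ++ B.

Definition eNP : exp := Input (Cst 0).
Definition eNN : exp := Input (Cst 1).
Definition eNR : exp := Input (Cst 2).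
Definition eInit : exp := Input (Cst 3).
Definition eFin : exp := Input (Cst 4).
Definition eOutBase : exp := Add (Cst 5) (Mul eNN eNP).
Definition eDltBase : exp := Add eOutBase (Mul eNN eNR).
Definition ePBase : exp := Add eDltBase (Mul eNN (Mul eNR eNP)).
(** The summand [Cst 0] gives the index the shape it has in [nums_P] for [k = 0], so that [eval_P1]
    holds by conversion. *)
Definition eP1 (x : nat) : exp :=
  Input (Add ePBase (Add (Cst 1) (Add (Mul (Var x) (Cst 2)) (Cst 0)))).
Definition eP2 (x : nat) : exp :=
  Input (Add ePBase (Add (Cst 1) (Add (Mul (Var x) (Cst 2)) (Cst 1)))).
Definition eBBase : exp := Add ePBase (Add (Cst 1) (Mul (Input ePBase) (Cst 2))).
Definition eB (x : nat) : exp := Input (Add eBBase (Add (Cst 1) (Var x))).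

(** Without the two bounds, an index out of range could read an entry of another row or table. *)
Definition eDom (n p : nat) : exp :=
  Mul (Lt (Var n) eNN) (Mul (Lt (Var p) eNP)
    (Input (Add (Cst 5) (Add (Mul (Var n) eNP) (Var p))))).
Definition eOut (n a : nat) : exp :=
  Mul (Lt (Var n) eNN) (Mul (Lt (Var a) eNR)
    (Input (Add eOutBase (Add (Mul (Var n) eNR) (Var a))))).
Definition eDlt (n a p : nat) : exp :=
  Input (Add eDltBase (Add (Mul (Var n) (Mul eNR eNP)) (Add (Mul (Var a) eNP) (Var p)))).

Section Instance.

Variables (Ng : negotiation) (P : seq (nat * nat)) (B : seq nat).

Notation indom := (indom Ng). Notation inout := (inout Ng). Notation dlt := (dlt Ng).
Notation np := (nproc Ng). Notation nn := (nnode Ng). Notation nr := (nres Ng).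
Notation nums := (instance_nums Ng P B).

Let domT := [seq [seq nat_of_bool (indom n p) | p <- iota 0 np] | n <- iota 0 nn].
Let outT := [seq [seq nat_of_bool (inout n a) | a <- iota 0 nr] | n <- iota 0 nn].
Let dltT := [seq flatten [seq [seq (if inout n a && indom n p then dlt n a p else 0)
           | p <- iota 0 np] | a <- iota 0 nr] | n <- iota 0 nn].

Let size_row (f : nat -> nat) k : size [seq f p | p <- iota 0 k] = k.
Proof. by rewrite size_map size_iota. Qed.

Let size_plane n : size (flatten [seq [seq (if inout n a && indom n p then dlt n a p else 0)
           | p <- iota 0 np] | a <- iota 0 nr]) = nr * np.
Proof. by rewrite (size_flatten_map (c := np)) ?size_iota // => a; apply: size_row. Qed.

Let size_domT : size (flatten domT) = nn * np.
Proof. by rewrite (size_flatten_map (c := np)) ?size_iota // => n; apply: size_row. Qed.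

Let size_outT : size (flatten outT) = nn * nr.
Proof. by rewrite (size_flatten_map (c := nr)) ?size_iota // => n; apply: size_row. Qed.

Let size_dltT : size (flatten dltT) = nn * (nr * np).
Proof. by rewrite (size_flatten_map (c := nr * np)) ?size_iota. Qed.

Lemma nums_dom n p : n < nn -> p < np -> nth 0 nums (5 + (n * np + p)) = indom n p.
Proof.
move=> hn hp; rewrite (@nth_cat_skip [:: _; _; _; _; _]) //.
rewrite (nth_cat_head _ size_domT); last by nia.
rewrite (nth_flatten_map 0 (c := np)) ?size_iota //.
by rewrite (nth_map 0) ?size_iota // !nth_iota.
Qed.

Lemma nums_out n a : n < nn -> a < nr ->
  nth 0 nums (5 + nn * np + (n * nr + a)) = inout n a.
Proof.
move=> hn ha; rewrite -addnA (@nth_cat_skip [:: _; _; _; _; _]) //.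
rewrite (nth_cat_skip _ _ size_domT) (nth_cat_head _ size_outT); last by nia.
rewrite (nth_flatten_map 0 (c := nr)) ?size_iota //.
by rewrite (nth_map 0) ?size_iota // !nth_iota.
Qed.

Lemma nums_dlt n a p : inout n a -> indom n p ->
  nth 0 nums (5 + nn * np + nn * nr + (n * (nr * np) + (a * np + p))) = dlt n a p.
Proof.
move=> ha hp; have [hn hp' _] := and3P hp; have [_ ha' _] := and3P ha.
rewrite -!addnA (@nth_cat_skip [:: _; _; _; _; _]) //.
rewrite (nth_cat_skip _ _ size_domT) (nth_cat_skip _ _ size_outT).
have lt : a * np + p < nr * np by rewrite /is_res /is_proc in ha' hp'; nia.
rewrite (nth_cat_head _ size_dltT); last by rewrite /is_node in hn; nia.
rewrite (nth_flatten_map 0 (c := nr * np)) ?size_iota //.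
rewrite (nth_flatten_map 0 (c := np)) ?size_iota //.
by rewrite (nth_map 0) ?size_iota // !nth_iota // !add0n ha hp.
Qed.

Let baseP := 5 + nn * np + nn * nr + nn * (nr * np).

Let nums_baseP k : nth 0 nums (baseP + k) =
  nth 0 ([:: size P] ++ flatten [seq [:: x.1; x.2] | x <- P] ++ [:: size B] ++ B) k.
Proof.
rewrite /baseP -!addnA (@nth_cat_skip [:: _; _; _; _; _]) //.
by rewrite (nth_cat_skip _ _ size_domT) (nth_cat_skip _ _ size_outT) (nth_cat_skip _ _ size_dltT).
Qed.

Let size_flatP : size (flatten [seq [:: x.1; x.2] | x <- P]) = size P * 2.
Proof. exact: size_flatten_map. Qed.

Lemma nums_sizeP : nth 0 nums baseP = size P.
Proof. by rewrite -[baseP]addn0 nums_baseP. Qed.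

Lemma nums_P i k : i < size P -> k < 2 ->
  nth 0 nums (baseP + (1 + (i * 2 + k))) =
    nth 0 [:: (nth (0, 0) P i).1; (nth (0, 0) P i).2] k.
Proof.
move=> hi hk; rewrite nums_baseP (@nth_cat_skip [:: _]) //.
rewrite (nth_cat_head _ size_flatP); last by nia.
exact: (nth_flatten_map (0, 0)).
Qed.

Lemma nums_sizeB : nth 0 nums (baseP + (1 + size P * 2)) = size B.
Proof.
rewrite nums_baseP (@nth_cat_skip [:: _]) // -[size P * 2]addn0.
by rewrite (nth_cat_skip _ _ size_flatP).
Qed.

Lemma nums_B i : nth 0 nums (baseP + (1 + size P * 2) + (1 + i)) = nth 0 B i.
Proof.
rewrite -addnA nums_baseP -addnA (@nth_cat_skip [:: _]) //.
by rewrite (nth_cat_skip _ _ size_flatP) (@nth_cat_skip [:: _]).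
Qed.

Notation L := (size (enc_nats nums)).

Lemma nums_lt j : nth 0 nums j < L.
Proof. exact: num_lt_size. Qed.

Lemma nn_lt : nn < L. Proof. exact: (nums_lt 1). Qed.
Lemma np_lt : np < L. Proof. exact: (nums_lt 0). Qed.
Lemma nr_lt : nr < L. Proof. exact: (nums_lt 2). Qed.

Lemma sizeP_lt : size P < L.
Proof. by rewrite -nums_sizeP; apply: nums_lt. Qed.

Lemma sizeB_lt : size B < L.
Proof. by rewrite -nums_sizeB; apply: nums_lt. Qed.

Notation eval := (eval L nums). Notation holds := (holds L nums).

Section Eval.

Variables (env : nat -> nat) (m : nat -> bool).

Lemma holds_ltN x c : x != 5 ->
  holds (Lt (Var x) (Input (Cst c))) env m <-> env x < nth 0 nums c.
Proof.
move=> hx; rewrite holds_lt //=; last by apply: ltnW; apply: nums_lt.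
by move=> v; rewrite updN.
Qed.

Lemma holds_dom n p : n != 5 -> p != 5 ->
  holds (eDom n p) env m <-> indom (env n) (env p).
Proof.
move=> hn hp; rewrite !holds_mul !holds_ltN //.
rewrite -[X in _ /\ _ /\ X]/(nth 0 nums (5 + (env n * np + env p)) <> 0).
split=> [[h1 [h2 h3]]|h].
  by move: h3; rewrite nums_dom //; case: indom.
by case/and3P: (h) => h1 h2 _; rewrite nums_dom // h.
Qed.

Lemma holds_out n a : n != 5 -> a != 5 ->
  holds (eOut n a) env m <-> inout (env n) (env a).
Proof.
move=> hn ha; rewrite !holds_mul !holds_ltN //.
rewrite -[X in _ /\ _ /\ X]/(nth 0 nums (5 + nn * np + (env n * nr + env a)) <> 0).
split=> [[h1 [h2 h3]]|h].
  by move: h3; rewrite nums_out //; case: inout.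
by case/and3P: (h) => h1 h2 _; rewrite nums_out // h.
Qed.

Lemma eval_dlt n a p : inout (env n) (env a) -> indom (env n) (env p) ->
  eval (eDlt n a p) env m = dlt (env n) (env a) (env p).
Proof. by move=> ha hp; apply: nums_dlt. Qed.

Lemma eval_P1 x : env x < size P -> eval (eP1 x) env m = (nth (0, 0) P (env x)).1.
Proof. by move=> hx; apply: (nums_P hx (k := 0)). Qed.

Lemma eval_P2 x : env x < size P -> eval (eP2 x) env m = (nth (0, 0) P (env x)).2.
Proof. by move=> hx; apply: (nums_P hx (k := 1)). Qed.

Lemma holds_ltP x : x != 5 -> holds (Lt (Var x) (Input ePBase)) env m <-> env x < size P.
Proof.
have e : eval (Input ePBase) env m = size P by apply: nums_sizeP.
move=> hx; rewrite holds_lt // ?e //; first by move=> v; rewrite /= updN.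
by apply: ltnW; apply: sizeP_lt.
Qed.

Lemma eval_BBase : eval eBBase env m = baseP + (1 + size P * 2).
Proof. by rewrite -nums_sizeP. Qed.

Lemma holds_ltB x : x != 5 -> holds (Lt (Var x) (Input eBBase)) env m <-> env x < size B.
Proof.
have e : eval (Input eBBase) env m = size B.
  by rewrite -nums_sizeB -eval_BBase.
move=> hx; rewrite holds_lt // ?e //; first by move=> v; rewrite /= updN.
by apply: ltnW; apply: sizeB_lt.
Qed.

Lemma eval_B x : eval (eB x) env m = nth 0 B (env x).
Proof. by rewrite -nums_B -eval_BBase. Qed.

End Eval.

End Instance.

(** * The tables and their correctness *)

(* Otherwise rewriting with [holds_mul] would also open these products. *)
Opaque eDom eOut eDlt.

(* Variables: 0 is a node, 1 a result, 2 a process, 3 an index into P or B, 4 and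
   7 further nodes, 5 is reserved for [Lt], 6 counts rounds; [tvar j], [xvar j]
   and [pvar j] are the target and position of token j and the process it follows. *)
Definition tvar (j : nat) : nat := (3 * j).+4.+4.+2.
Definition xvar (j : nat) : nat := (3 * j).+4.+4.+3.
Definition pvar (j : nat) : nat := (3 * j).+4.+4.+4.

Definition eAddr (tag : nat) (es : seq exp) : exp :=
  Add (Mul (Cst 3) (foldr (fun e acc => Add e (Mul eNN acc)) (Cst 0) es)) (Cst tag).
Definition eTab (tag : nat) (es : seq exp) : exp := Tab (eAddr tag es).

Definition eEdge (x y : nat) : exp :=
  Ex 1 (Ex 2 (Mul (eOut x 1) (Mul (eDom x 2) (Eq (eDlt x 1 2) (Var y))))).
Definition eAllowed (x a : nat) : exp :=
  Mul (eOut x a)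
    (Mul (All 3 (Imp (Lt (Var 3) (Input eBBase)) (Not (Eq (eB 3) (Var x)))))
      (All 3 (Imp (Lt (Var 3) (Input ePBase))
        (Imp (Eq (eP1 3) (Var x)) (Eq (eP2 3) (Var a)))))).
Definition eWins (x a : nat) : exp :=
  Mul (eAllowed x a) (All 2 (Imp (eDom x 2) (eTab 1 [:: eDlt x a 2]))).

Definition path_addr : exp := eAddr 0 [:: Var 0; Var 4].
Definition path_cond : exp :=
  Mul (Lt (Var 0) eNN) (Mul (Lt (Var 4) eNN)
    (Ex 7 (Mul (eEdge 0 7) (Add (Eq (Var 7) (Var 4)) (eTab 0 [:: Var 7; Var 4]))))).

Definition win_addr : exp := eAddr 1 [:: Var 0].
Definition win_cond : exp :=
  Mul (Lt (Var 0) eNN) (Add (Eq (Var 0) eFin) (Ex 1 (eWins 0 1))).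

Definition eTuple (K : nat) (F : nat -> exp) : seq exp := map F (iota 0 K).
(** A conditional written as arithmetic: when the token stays, the possibly meaningless value of
    [eDlt] is multiplied by 0. *)
Definition eMoved (j : nat) : exp :=
  let c := Mul (Eq (Var (xvar j)) (Var 0)) (Not (Eq (Var (xvar j)) (Var (tvar j)))) in
  Add (Mul c (eDlt 0 1 (pvar j))) (Mul (Not c) (Var (xvar j))).
Definition tok_addr (K : nat) : exp :=
  eAddr 2 (eTuple K (fun j => Var (tvar j)) ++ eTuple K (fun j => Var (xvar j))).
Definition tok_guard (j : nat) : exp :=
  Mul (Lt (Var (tvar j)) eNN) (Mul (Lt (Var (xvar j)) eNN) (eTab 1 [:: Var (xvar j)])).
(** The negated lookup is faithful only once the reachability table is complete, which is why the
    tables are filled one after the other. *)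
Definition tok_free (j : nat) : exp :=
  Mul (eDom 0 (pvar j))
    (Add (Eq (Var (xvar j)) (Var (tvar j))) (Not (eTab 0 [:: Var (xvar j); Var 0]))).
Definition tok_cond (K : nat) : exp :=
  Mul (Conj (eTuple K tok_guard))
    (Add (Conj (eTuple K (fun j => Eq (Var (xvar j)) (Var (tvar j)))))
      (Mul (Not (Eq (Var 0) eFin)) (Mul (eWins 0 1) (Mul (Conj (eTuple K tok_free))
        (eTab 2 (eTuple K (fun j => Var (tvar j)) ++ eTuple K eMoved)))))).
Definition tok_vars (K : nat) : seq nat :=
  0 :: 1 :: flatten [seq [:: tvar j; xvar j; pvar j] | j <- iota 0 K].

Definition tables (K : nat) : stmt :=
  Then (Fors (nseq 1 6) (rule path_cond path_addr [:: 0; 4]))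
    (Then (Fors (nseq 1 6) (rule win_cond win_addr [:: 0]))
      (Fors (nseq K.+1 6) (rule (tok_cond K) (tok_addr K) (tok_vars K)))).

Definition covers (K : nat) : exp :=
  All 3 (Imp (Lt (Var 3) (Input ePBase))
    (Mul (Not (Eq (eP1 3) eFin)) (Disj (eTuple K (fun j => Eq (Var (tvar j)) (eP1 3)))))).
Definition accepts (K : nat) : exp :=
  Mul (eTab 1 [:: eInit])
    (Exs (map tvar (iota 0 K))
      (Mul (Conj (eTuple K (fun j => Lt (Var (tvar j)) eNN)))
        (Mul (covers K)
          (eTab 2 (eTuple K (fun j => Var (tvar j)) ++ eTuple K (fun _ => eInit)))))).

Section Correctness.

Variables (Ng : negotiation) (P : seq (nat * nat)) (B : seq nat) (K : nat).
Hypothesis wfN : wf_negotiation Ng.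
Hypothesis acyc : acyclic Ng.
Hypothesis snd : sound Ng.
Hypothesis P_size : size (undup P) <= K.
Hypothesis P_nodes : forall x, x \in P -> is_node Ng x.1.

Notation indom := (indom Ng). Notation inout := (inout Ng). Notation dlt := (dlt Ng).
Notation ninit := (ninit Ng). Notation nfin := (nfin Ng).
Notation np := (nproc Ng). Notation nn := (nnode Ng). Notation nr := (nres Ng).
Notation nums := (instance_nums Ng P B).
Notation L := (size (enc_nats nums)).
Notation eval := (eval L nums). Notation holds := (holds L nums).
Notation run := (run_stmt L nums).
Notation Win := (Win Ng P B). Notation wins := (winning_result Ng P B).
Notation allowed := (allowed Ng P B). Notation joint := (joint_paths Ng P B K).
Notation path := (path_plus Ng).

Lemma eval_addr tag es env m :
  eval (eAddr tag es) env m = addr nn tag (map (fun e => eval e env m) es).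
Proof. by rewrite /addr /=; congr (3 * _ + _); elim: es => //= e es ->. Qed.

Lemma holds_eTab tag es env m :
  holds (eTab tag es) env m <-> m (addr nn tag (map (fun e => eval e env m) es)).
Proof. by rewrite holds_tab eval_addr. Qed.

Lemma holds_ltnn x env m : x != 5 -> holds (Lt (Var x) eNN) env m <-> env x < nn.
Proof. exact: holds_ltN. Qed.

Lemma holds_edge (x y : nat) env m : x \notin [:: 1; 2; 5] -> y \notin [:: 1; 2; 5] ->
  holds (eEdge x y) env m <-> edge Ng (env x) (env y).
Proof.
rewrite !inE !negb_or => /and3P [x1 x2 x5] /and3P [y1 y2 y5].
have e2 a p : upd (upd env 1 a) 2 p 1 = a by [].
have ex a p : upd (upd env 1 a) 2 p x = env x by rewrite !updN.
have ey a p : upd (upd env 1 a) 2 p y = env y by rewrite !updN.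
rewrite holds_ex; split.
  case=> a _; rewrite holds_ex => -[p _].
  rewrite 2!holds_mul holds_out // holds_dom // holds_eq e2 ex updE => -[h1 [h2]].
  by rewrite eval_dlt ?e2 ?ex ?updE //= ey => h3; exists a, p.
case=> a [p [h1 [h2 h3]]]; have [_ ha _] := and3P h1; have [_ hp _] := and3P h2.
exists a; first exact: ltn_trans ha (nr_lt _ _ _).
rewrite holds_ex; exists p; first exact: ltn_trans hp (np_lt _ _ _).
rewrite 2!holds_mul holds_out // holds_dom // holds_eq e2 ex updE; split=> //; split=> //.
by rewrite eval_dlt ?e2 ?ex ?updE //= ey.
Qed.

Opaque eEdge.

Lemma holds_allowed (x a : nat) env m : x \notin [:: 3; 5] -> a \notin [:: 3; 5] ->
  holds (eAllowed x a) env m <-> allowed (env x) (env a).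
Proof.
rewrite !inE !negb_or => /andP [x3 x5] /andP [a3 a5].
rewrite 2!holds_mul holds_out // !holds_all; split.
  case=> h1 [h2 h3]; split=> //.
    apply/negP => /(nthP 0) [i hi hx].
    have := h2 i (ltn_trans hi (sizeB_lt _ _ _)).
    rewrite holds_imp holds_ltB // holds_not holds_eq eval_B updE hx /= updN //.
    by move=> /(_ hi).
  move=> y /(nthP (0, 0)) [i hi <-] hx.
  have := h3 i (ltn_trans hi (sizeP_lt _ _ _)).
  rewrite !holds_imp holds_ltP // !holds_eq updE => h.
  by move: (h hi); rewrite eval_P1 ?eval_P2 updE //= !updN //; apply.
case=> h1 h2 h3; split=> //; split=> i _; rewrite !holds_imp.
  rewrite holds_ltB // holds_not holds_eq eval_B updE /= updN // => hi hx.
  by move/negP: h2; apply; rewrite -hx mem_nth.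
rewrite holds_ltP // !holds_eq updE => hi.
rewrite eval_P1 ?eval_P2 updE //= !updN // => hx.
by apply: h3 => //; apply: mem_nth.
Qed.

Opaque eAllowed.

Lemma holds_wins (x a : nat) env m : x \notin [:: 2; 3; 5] -> a \notin [:: 2; 3; 5] ->
  holds (eWins x a) env m <-> allowed (env x) (env a) /\
    forall p, indom (env x) p -> m (addr nn 1 [:: dlt (env x) (env a) p]).
Proof.
rewrite !inE !negb_or => /and3P [x2 x3 x5] /and3P [a2 a3 a5].
rewrite holds_mul holds_allowed ?inE ?negb_or ?x3 ?a3 // holds_all; split; case=> h1 h2; split=> //.
  move=> p hp; have [_ lp _] := and3P hp; have [hin _ _] := h1.
  have := h2 p (ltn_trans lp (np_lt _ _ _)).
  rewrite holds_imp holds_dom // updE updN // => /(_ hp).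
  by rewrite holds_eTab /map eval_dlt ?updE !updN.
move=> p _; rewrite holds_imp holds_dom // updE updN // => hp; have [hin _ _] := h1.
by rewrite holds_eTab /map eval_dlt ?updE !updN //; apply: h2.
Qed.

Opaque eWins.

Definition tup (t : nat -> nat) : seq nat := map t (iota 0 K).

Lemma size_tup t : size (tup t) = K.
Proof. by rewrite size_map size_iota. Qed.

Lemma all_tup (t : nat -> nat) : (forall j, j < K -> t j < nn) -> all (fun v => v < nn) (tup t).
Proof. by move=> h; rewrite all_map; apply/allP => j; rewrite mem_iota => /h. Qed.

Lemma tup_inj t t' : tup t = tup t' -> forall j, j < K -> t j = t' j.
Proof.
move=> e j hj; have := congr1 (fun s => nth 0 s j) e.
by rewrite !(nth_map 0) ?size_iota // !nth_iota.
Qed.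

Lemma eval_tuple (F : nat -> exp) (f : nat -> nat) env m :
  (forall j, j < K -> eval (F j) env m = f j) ->
  map (fun e => eval e env m) (eTuple K F) = tup f.
Proof.
move=> h; rewrite /eTuple -map_comp; apply/eq_in_map => j; rewrite mem_iota => /= hj.
exact: h.
Qed.

Lemma joint_ext t t' x x' : (forall j, j < K -> t j = t' j /\ x j = x' j) ->
  joint t x -> joint t' x'.
Proof.
move=> h [sg [h1 h2]]; exists sg; split=> // j hj.
by have [<- <-] := h j hj; apply: h2.
Qed.

(** * Soundness and completeness of the tables *)

Definition path_sound (ad : nat) : Prop :=
  forall n n', n < nn -> n' < nn -> ad = addr nn 0 [:: n; n'] -> path n n'.
Definition win_sound (ad : nat) : Prop := forall n, n < nn -> ad = addr nn 1 [:: n] -> Win n.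
Definition tok_sound (ad : nat) : Prop := forall t x, (forall j, j < K -> t j < nn) ->
  (forall j, j < K -> x j < nn) -> ad = addr nn 2 (tup t ++ tup x) -> joint t x.

(** All three readings of an address are required to be true, so setting an entry is a single
    obligation; the tag makes two of the readings vacuous. *)
Definition tables_sound (m : nat -> bool) : Prop :=
  forall ad, m ad -> [/\ path_sound ad, win_sound ad & tok_sound ad].
Definition path_complete (m : nat -> bool) : Prop :=
  forall n n', path n n' -> m (addr nn 0 [:: n; n']).
Definition win_complete (m : nat -> bool) : Prop :=
  forall n, Win n -> m (addr nn 1 [:: n]).

Lemma sound_path m n n' : tables_sound m -> n < nn -> n' < nn ->
  m (addr nn 0 [:: n; n']) -> path n n'.
Proof. by move=> h hn hn' /h [hp _ _]; apply: hp. Qed.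

Lemma sound_win m n : tables_sound m -> n < nn -> m (addr nn 1 [:: n]) -> Win n.
Proof. by move=> h hn /h [_ hw _]; apply: hw. Qed.

Lemma sound_tok m t x : tables_sound m -> (forall j, j < K -> t j < nn) ->
  (forall j, j < K -> x j < nn) -> m (addr nn 2 (tup t ++ tup x)) -> joint t x.
Proof. by move=> h ht hx /h [_ _ hj]; apply: hj. Qed.

Lemma tables_sound_upd m ad : tables_sound m ->
  [/\ path_sound ad, win_sound ad & tok_sound ad] -> tables_sound (upd m ad true).
Proof. by move=> hm had ad'; rewrite /upd; case: eqP => [->|_ /hm]. Qed.

Lemma upd_true_le (m : nat -> bool) ad : mem_le m (upd m ad true).
Proof. by move=> ad' h; rewrite /upd; case: eqP. Qed.

Lemma tag_neq tag tag' vs vs' : tag < 3 -> tag' < 3 -> tag != tag' ->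
  addr nn tag vs <> addr nn tag' vs'.
Proof. by move=> h h' /eqP ne /addr_inj -/(_ h h') [e _]; apply: ne. Qed.

Lemma path_addr_sound n n' : n < nn -> n' < nn -> path n n' ->
  [/\ path_sound (addr nn 0 [:: n; n']), win_sound (addr nn 0 [:: n; n'])
    & tok_sound (addr nn 0 [:: n; n'])].
Proof.
move=> hn hn' hp; split.
- move=> k k' hk hk' /(addr_inj (isT : 0 < 3) (isT : 0 < 3)) [_ e].
  by have [<- <-] : [:: n; n'] = [:: k; k'] by apply: e; rewrite //= ?hn ?hn' ?hk ?hk'.
- by move=> k _ /tag_neq; case.
- by move=> t x _ _ /tag_neq; case.
Qed.

Lemma win_addr_sound n : n < nn -> Win n ->
  [/\ path_sound (addr nn 1 [:: n]), win_sound (addr nn 1 [:: n])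
    & tok_sound (addr nn 1 [:: n])].
Proof.
move=> hn hw; split.
- by move=> k k' _ _ /tag_neq; case.
- move=> k hk /(addr_inj (isT : 1 < 3) (isT : 1 < 3)) [_ e].
  by have [<-] : [:: n] = [:: k] by apply: e; rewrite //= ?hn ?hk.
- by move=> t x _ _ /tag_neq; case.
Qed.

Lemma tok_addr_sound t x : (forall j, j < K -> t j < nn) -> (forall j, j < K -> x j < nn) ->
  joint t x ->
  [/\ path_sound (addr nn 2 (tup t ++ tup x)), win_sound (addr nn 2 (tup t ++ tup x))
    & tok_sound (addr nn 2 (tup t ++ tup x))].
Proof.
move=> ht hx hj; split.
- by move=> k k' _ _ /tag_neq; case.
- by move=> k _ /tag_neq; case.
- move=> t' x' ht' hx' /(addr_inj (isT : 2 < 3) (isT : 2 < 3)) [_ e].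
  have : tup t ++ tup x = tup t' ++ tup x'.
    by apply: e; rewrite ?size_cat ?size_tup // all_cat !all_tup.
  move/eqP; rewrite eqseq_cat ?size_tup // => /andP [/eqP /tup_inj et /eqP /tup_inj ex].
  by apply: joint_ext hj => j hj'; rewrite et // ex.
Qed.

Lemma win_node n : Win n -> n < nn.
Proof. by case=> [|k a [h _ _] _]; [exact: fin_node | exact: inout_node h]. Qed.

Lemma node_lt n : n < nn -> n < L.
Proof. by move=> h; apply: ltn_trans h (nn_lt _ _ _). Qed.

Lemma path_rule_sound env m : tables_sound m -> holds path_cond env m ->
  tables_sound (upd m (eval path_addr env m) true).
Proof.
move=> hm; rewrite eval_addr 2!holds_mul !holds_ltnn // holds_ex => -[h0 [h4 [k _]]].
rewrite holds_mul holds_edge // holds_add holds_eq holds_eTab /=.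
rewrite -[upd env 7 k 0]/(env 0) -[upd env 7 k 4]/(env 4) updE => -[he hk].
apply: tables_sound_upd => //; apply: path_addr_sound => //.
have [_ kn] := edge_nodes wfN he.
case: hk => [<-|hk]; first exact: pp_one.
exact: pp_cons he (sound_path hm kn h4 hk).
Qed.

(** The first edge of a path lowers the rank of its source, so one round adds the pair once the
    pairs with sources of lower rank are present. *)
Lemma path_rule_complete env m ad n n' : path n n' -> ad = addr nn 0 [:: n; n'] ->
  tables_sound m -> (forall k, path k n' -> rank Ng k < rank Ng n -> m (addr nn 0 [:: k; n'])) ->
  run (rule path_cond path_addr [:: 0; 4]) env m ad.
Proof.
move=> hp -> hm hrec; have [hn hn'] := path_plus_nodes wfN hp.
pose env' := upd (upd env 0 n) 4 n'.
apply: (rule_complete path_rule_sound (env' := env') hm).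
  split=> y; rewrite !inE; first by rewrite negb_or => /andP [y0 y4]; rewrite /env' !updN.
  by case/orP => /eqP ->; apply: node_lt.
move=> m' hm' le; split; last by rewrite eval_addr.
rewrite 2!holds_mul !holds_ltnn //; split=> //; split=> //; rewrite holds_ex.
have [k [he hk]] : exists k, edge Ng n k /\ (k = n' \/ path k n').
  by case: hp => [a b e|a b c e h]; [exists b; split=> //; left | exists b; split=> //; right].
have [_ kn] := edge_nodes wfN he.
exists k; first exact: node_lt.
rewrite holds_mul holds_edge // holds_add holds_eq holds_eTab /= updE.
split=> //; case: hk => [->|hk]; [by left | right].
by apply: le; apply: hrec => //; apply: rank_edge he.
Qed.

Lemma win_rule_sound env m : tables_sound m -> holds win_cond env m ->
  tables_sound (upd m (eval win_addr env m) true).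
Proof.
move=> hm; rewrite holds_mul holds_ltnn // holds_add holds_eq holds_ex => -[h0 hw].
rewrite eval_addr; apply: tables_sound_upd => //; apply: win_addr_sound => //.
case: hw => [/= ->|[a _]]; first exact: WinFin.
rewrite holds_wins // -[upd env 1 a 0]/(env 0) updE => -[ha hs].
apply: (WinStep ha) => p hp; have [hin _ _] := ha.
by apply: (sound_win hm); [case: (dlt_dom wfN hin hp) | apply: hs].
Qed.

Lemma win_rule_complete env m ad n : Win n -> ad = addr nn 1 [:: n] -> tables_sound m ->
  (forall k, Win k -> rank Ng k < rank Ng n -> m (addr nn 1 [:: k])) ->
  run (rule win_cond win_addr [:: 0]) env m ad.
Proof.
move=> hw -> hm hrec; have hn := win_node hw.
pose env' := upd env 0 n.
apply: (rule_complete win_rule_sound (env' := env') hm).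
  split=> y; rewrite !inE; first by move=> y0; rewrite /env' updN.
  by move/eqP => ->; apply: node_lt.
move=> m' hm' le; split; last by rewrite eval_addr.
rewrite holds_mul holds_ltnn //; split=> //; rewrite holds_add holds_eq holds_ex.
case: hw hrec {hn} @env' => [|k a ha hs] hrec env'; [by left | right].
have [hin _ _] := ha; have [_ la _] := and3P hin.
exists a; first exact: ltn_trans la (nr_lt _ _ _).
rewrite holds_wins // -[upd env' 1 a 0]/k updE; split=> // p hp.
apply: le; apply: hrec; first exact: hs.
by apply: rank_edge => //; apply: edge_dlt.
Qed.

(** Invariant of the third phase: the first two tables are exact, the third is only sound so far. *)
Definition full_paths_wins (m : nat -> bool) : Prop :=
  [/\ tables_sound m, path_complete m & win_complete m].

Lemma full_win m n : full_paths_wins m -> n < nn -> m (addr nn 1 [:: n]) <-> Win n.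
Proof. by case=> hs _ hw hn; split; [apply: sound_win hs hn | apply: hw]. Qed.

Lemma full_wins (x a : nat) env m : full_paths_wins m -> x \notin [:: 2; 3; 5] -> a \notin [:: 2; 3; 5] ->
  holds (eWins x a) env m <-> wins (env x) (env a).
Proof.
move=> hm hx ha; rewrite holds_wins //; split=> -[h1 h2]; split=> // p hp;
  have [hin _ _] := h1; have [dn _] := dlt_dom wfN hin hp.
  by apply/(full_win hm dn); apply: h2.
by apply/(full_win hm dn); apply: h2.
Qed.

Lemma eval_moved j env m : wins (env 0) (env 1) -> indom (env 0) (env (pvar j)) ->
  eval (eMoved j) env m = moved Ng (fun j => env (tvar j)) (fun j => env (xvar j))
    (env 0) (env 1) (fun j => env (pvar j)) j.
Proof.
case=> [[hin _ _] _] hp; rewrite /moved -(eval_dlt P B m hin hp).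
rewrite /eMoved [LHS]/= -/(eDlt 0 1 (pvar j)).
by case: (_ =P env 0) => _ /=; case: (_ =P env (tvar j)) => _ /=; lia.
Qed.

Lemma holds_tok_cond env m : full_paths_wins m ->
  let t j := env (tvar j) in let x j := env (xvar j) in let p j := env (pvar j) in
  holds (tok_cond K) env m <->
  (forall j, j < K -> t j < nn /\ Win (x j)) /\
  ((forall j, j < K -> x j = t j) \/
   [/\ env 0 <> nfin, legal_move Ng P B K t x (env 0) (env 1) p &
     m (addr nn 2 (tup t ++ tup (moved Ng t x (env 0) (env 1) p)))]).
Proof.
move=> hm t x p; have [hs hpc hwc] := hm.
have guardE : holds (Conj (eTuple K tok_guard)) env m <->
    forall j, j < K -> t j < nn /\ Win (x j).
  rewrite holds_conj; split=> h j hj.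
    have := h j; rewrite mem_iota => /(_ hj); rewrite 2!holds_mul !holds_ltnn // holds_eTab.
    by case=> h1 [h2 /(full_win hm h2)].
  move: hj; rewrite mem_iota => hj; have [h1 h2] := h j hj; have h3 := win_node h2.
  rewrite 2!holds_mul !holds_ltnn // holds_eTab; split=> //; split=> //.
  exact/(full_win hm h3).
rewrite holds_mul guardE; split=> -[hg hor]; split=> //; move: hor; rewrite holds_add.
- rewrite 3!holds_mul holds_not holds_eq full_wins // => -[|[h1 [h2 [h3 h4]]]].
    rewrite holds_conj => h; left=> j hj.
    by have := h j; rewrite mem_iota holds_eq => /(_ hj).
  right; have hp j : j < K -> indom (env 0) (p j) /\ (x j <> t j -> ~ path (x j) (env 0)).
    move=> hj; move: h3; rewrite holds_conj => /(_ j); rewrite mem_iota => /(_ hj).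
    rewrite holds_mul holds_dom // holds_add holds_eq holds_not holds_eTab.
    by case=> h5 h6; split=> // h7 h8; case: h6 => // h6; apply: h6; apply: hpc.
  split=> //.
  move: h4; rewrite holds_eTab map_cat (@eval_tuple _ t) //.
  rewrite (@eval_tuple _ (moved Ng t x (env 0) (env 1) p)) // => j hj.
  by rewrite eval_moved //; case: (hp j hj).
- case=> [h|[h1 [h2 hp] h3]]; [left | right].
    rewrite holds_conj => j; rewrite mem_iota => /= hj; rewrite holds_eq; exact: h.
  rewrite 3!holds_mul holds_not holds_eq full_wins //; split=> //; split=> //; split.
    rewrite holds_conj => j; rewrite mem_iota => /= hj; have [h5 h6] := hp j hj.
    rewrite holds_mul holds_dom // holds_add holds_eq holds_not holds_eTab; split=> //.
    case: (x j =P t j) => [e|ne]; [by left | right=> hq; apply: (h6 ne)].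
    apply: (sound_path hs _ _ hq); last by case: h2 => -[/inout_node].
    by apply: win_node; case: (hg j hj).
  rewrite holds_eTab map_cat (@eval_tuple _ t) //.
  rewrite (@eval_tuple _ (moved Ng t x (env 0) (env 1) p)) // => j hj.
  by rewrite eval_moved //; case: (hp j hj).
Qed.

Lemma tok_rule_sound env m : full_paths_wins m -> holds (tok_cond K) env m ->
  full_paths_wins (upd m (eval (tok_addr K) env m) true).
Proof.
move=> hm; rewrite eval_addr map_cat (@eval_tuple _ (fun j => env (tvar j))) //.
rewrite (@eval_tuple _ (fun j => env (xvar j))) // holds_tok_cond //=.
have [hs hpc hwc] := hm.
set t := fun j => env (tvar j); set x := fun j => env (xvar j); set p := fun j => env (pvar j).
case=> hg hor; split; first last.
- by move=> n /hwc; apply: upd_true_le.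
- by move=> n n' /hpc; apply: upd_true_le.
apply: tables_sound_upd => //; apply: tok_addr_sound => [j /hg []//|j /hg [_ /win_node]//|].
case: hor => [h|[h1 h2 h3]]; first exact: joint_paths_done.
have hwx j : j < K -> Win (x j) by case/hg.
apply: (joint_paths_move acyc h1 hwx h2).
apply: (sound_tok hs _ _ h3) => j hj; first by case: (hg j hj).
rewrite /moved; case: ifP => _; last by apply: win_node; apply: hwx.
by apply: win_node; case: h2 => -[_ hw] hp; apply: hw; case: (hp j hj).
Qed.

Lemma tok_varsP y : y \in tok_vars K ->
  [\/ y = 0, y = 1 | exists2 j, j < K & [\/ y = tvar j, y = xvar j | y = pvar j]].
Proof.
rewrite !inE => /or3P [/eqP|/eqP|/flattenP [s /mapP [j hj ->]]];
  [by constructor 1 | by constructor 2 |].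
move: hj; rewrite mem_iota => /= hj; rewrite !inE => h; constructor 3; exists j => //.
by case/or3P: h => /eqP; [constructor 1 | constructor 2 | constructor 3].
Qed.

Lemma tok_vars_mem j y : j < K -> y \in [:: tvar j; xvar j; pvar j] -> y \in tok_vars K.
Proof.
move=> hj hy; rewrite !inE; apply/or3P; constructor 3; apply/flattenP.
by exists [:: tvar j; xvar j; pvar j] => //; apply/mapP; exists j; rewrite ?mem_iota.
Qed.

(** Inverts the numbering by [tvar], [xvar] and [pvar], which starts at 10 and takes the three kinds
    in turn modulo 3. *)
Definition tok_env (env : nat -> nat) (n a : nat) (t x p : nat -> nat) (y : nat) : nat :=
  if y \notin tok_vars K then env y
  else if y == 0 then n else if y == 1 then a
  else match (y - 10) %% 3 with
       | 0 => t ((y - 10) %/ 3) | 1 => x ((y - 10) %/ 3) | _ => p ((y - 10) %/ 3)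
       end.

Lemma tok_envE env n a t x p : let env' := tok_env env n a t x p in
  [/\ env' 0 = n, env' 1 = a & forall j, j < K ->
    [/\ env' (tvar j) = t j, env' (xvar j) = x j & env' (pvar j) = p j]].
Proof.
split=> // j hj; rewrite /tok_env !(tok_vars_mem hj) ?inE ?eqxx ?orbT //=.
have -> : tvar j - 10 = j * 3 + 0 by rewrite /tvar; lia.
have -> : xvar j - 10 = j * 3 + 1 by rewrite /xvar; lia.
have -> : pvar j - 10 = j * 3 + 2 by rewrite /pvar; lia.
by rewrite !modnMDl !divnMDl // !addn0.
Qed.

Lemma tok_env_agree env n a t x p : n < L -> a < L ->
  (forall j, j < K -> [/\ t j < L, x j < L & p j < L]) ->
  agree_off (tok_vars K) L env (tok_env env n a t x p).
Proof.
move=> hn ha h; split=> y hy; first by rewrite /tok_env hy.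
have [h0 h1 h2] := tok_envE env n a t x p.
case: (tok_varsP hy) => [->|->|[j hj hjy]]; rewrite ?h0 ?h1 //.
have [e1 e2 e3] := h2 j hj; have [l1 l2 l3] := h j hj.
by case: hjy => ->; rewrite ?e1 ?e2 ?e3.
Qed.

Lemma tok_rule_complete env m t x : (forall j, j < K -> t j < nn) ->
  (forall j, j < K -> Win (x j)) -> joint t x -> full_paths_wins m ->
  (forall x', (forall j, j < K -> Win (x' j)) -> joint t x' ->
     total_rank Ng K x' < total_rank Ng K x -> m (addr nn 2 (tup t ++ tup x'))) ->
  run (rule (tok_cond K) (tok_addr K) (tok_vars K)) env m (addr nn 2 (tup t ++ tup x)).
Proof.
move=> ht hx hj hm hrec.
have tup_eq (u v : nat -> nat) : (forall j, j < K -> u j = v j) -> tup u = tup v.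
  by move=> h; apply/eq_in_map => j; rewrite mem_iota; apply: h.
have L0 : 0 < L by apply: leq_ltn_trans (nn_lt Ng P B).
have tL j : j < K -> t j < L by move=> hj'; apply/node_lt/ht.
have xL j : j < K -> x j < L by move=> hj'; apply/node_lt/win_node/hx.
suff [n [a [p [hn ha hp hstep]]]] : exists n a p, [/\ n < L, a < L, forall j, j < K -> p j < L &
    (forall j, j < K -> x j = t j) \/
    [/\ n <> nfin, legal_move Ng P B K t x n a p &
      m (addr nn 2 (tup t ++ tup (moved Ng t x n a p)))]].
  pose env' := tok_env env n a t x p; have [e0 e1 ej] := tok_envE env n a t x p.
  apply: (rule_complete tok_rule_sound (env' := env') hm).
    by apply: tok_env_agree => // j hj'; split; [apply: tL | apply: xL | apply: hp].
  have et j : j < K -> env' (tvar j) = t j by case/ej.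
  have ex j : j < K -> env' (xvar j) = x j by case/ej.
  have ep j : j < K -> env' (pvar j) = p j by case/ej.
  move=> m' hm' le; split; last first.
    by rewrite eval_addr map_cat (@eval_tuple _ t) // (@eval_tuple _ x).
  rewrite -/env' in e0 e1; rewrite holds_tok_cond // e0 e1; split=> [j hj'|]; first by rewrite et // ex //; auto.
  case: hstep => [h|[h1 [h2 h3] h4]]; [left=> j hj' | right]; first by rewrite et // ex // h.
  split=> //; first by split=> // j hj'; rewrite ep // ex // et //; apply: h3.
  apply: le; move: h4; congr (m (addr _ _ (_ ++ _))); apply: tup_eq => j hj'; first by rewrite et.
  by rewrite /moved ex // et // ep.
case: (joint_paths_unfold wfN acyc hx hj) => [h|[n [a [p [h1 h2 h3 h4 h5]]]]].
  (* If all tokens have arrived, the values of the node, result and process variables are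
     arbitrary. *)
  by exists 0, 0, (fun _ => 0); split=> //; left.
have [[[hin _ _] _] hp] := h2; have [hn ha _] := and3P hin.
exists n, a, p; split=> [|||//]; first exact: node_lt.
- exact: ltn_trans ha (nr_lt _ _ _).
- by move=> j /hp [/and3P [_ lp _] _]; apply: ltn_trans lp (np_lt _ _ _).
- by right; split=> //; apply: hrec.
Qed.

Lemma L_gt1 : 1 < L.
Proof. exact: leq_ltn_trans (leq_ltn_trans (leq0n _) (init_node wfN)) (nn_lt _ _ _). Qed.

Theorem tables_correct env m0 : (forall ad, ~~ m0 ad) ->
  let m := run (tables K) env m0 in full_paths_wins m /\
  forall t x, (forall j, j < K -> t j < nn) -> (forall j, j < K -> Win (x j)) ->
    m (addr nn 2 (tup t ++ tup x)) <-> joint t x.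
Proof.
move=> hm0 m.
pose m1 := run (Fors (nseq 1 6) (rule path_cond path_addr [:: 0; 4])) env m0.
pose m2 := run (Fors (nseq 1 6) (rule win_cond win_addr [:: 0])) env m1.
have em : m = run (Fors (nseq K.+1 6) (rule (tok_cond K) (tok_addr K) (tok_vars K))) env m2.
  by [].
(* [R1], [R2] and [R3] express that after [i] rounds all true entries of rank below [i] are present,
   for pairs, nodes and tuples respectively. *)
pose R1 i (m : nat -> bool) := tables_sound m /\
  forall n n', path n n' -> rank Ng n < i -> m (addr nn 0 [:: n; n']).
have s1 env' m' i : R1 i m' -> R1 i.+1 (run (rule path_cond path_addr [:: 0; 4]) env' m').
  case=> h1 h2; split; first exact: (rule_inv path_rule_sound).
  move=> n n' hp hr; apply: path_rule_complete hp _ h1 _ => // k hk hr'.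
  by apply: h2 => //; lia.
have r1 : R1 0 m0 by split=> // ad; rewrite (negbTE (hm0 ad)).
have [sd1 pc1] : tables_sound m1 /\ path_complete m1.
  have [h1 h2] := rounds 1 env s1 r1; split=> // n n' hp; apply: h2 => //.
  by rewrite expn1; apply: leq_ltn_trans (rank_le _ _) (nn_lt _ _ _).
pose R2 i (m : nat -> bool) := [/\ tables_sound m, path_complete m &
  forall n, Win n -> rank Ng n < i -> m (addr nn 1 [:: n])].
have s2 env' m' i : R2 i m' -> R2 i.+1 (run (rule win_cond win_addr [:: 0]) env' m').
  case=> h1 h2 h3; split; first exact: (rule_inv win_rule_sound).
    by move=> n n' /h2; apply: run_stmt_le.
  move=> n hp hr; apply: win_rule_complete hp _ h1 _ => // k hk hr'.
  by apply: h3 => //; lia.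
have r2 : R2 0 m1 by [].
have f2 : full_paths_wins m2.
  have [h1 h2 h3] := rounds 1 env s2 r2; split=> // n hp; apply: h3 => //.
  by rewrite expn1; apply: leq_ltn_trans (rank_le _ _) (nn_lt _ _ _).
pose R3 i (m : nat -> bool) := full_paths_wins m /\ forall t x, (forall j, j < K -> t j < nn) ->
  (forall j, j < K -> Win (x j)) -> joint t x -> total_rank Ng K x < i ->
  m (addr nn 2 (tup t ++ tup x)).
have s3 env' m' i : R3 i m' ->
    R3 i.+1 (run (rule (tok_cond K) (tok_addr K) (tok_vars K)) env' m').
  case=> h1 h2; split; first exact: (rule_inv tok_rule_sound).
  move=> t x ht hx hj hr; apply: tok_rule_complete => // x' hx' hj' hr'.
  by apply: h2 => //; lia.
have r3 : R3 0 m2 by [].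
have := rounds K.+1 env s3 r3; rewrite -em => -[f3 c3].
split=> // t x ht hx; split=> [hm|hj].
  by case: f3 => hs _ _; apply: (sound_tok hs) hm => // j hj; apply: win_node; apply: hx.
apply: c3 => //; rewrite add0n expnS.
(* Total ranks are at most [K * nn], and [K < 2 ^ K <= L ^ K] with [nn < L] puts this below the
   [L ^ K.+1] rounds. *)
have kl : K < L ^ K by apply: leq_trans (ltn_expl K (isT : 1 < 2)) _; case: (K) => // k;
  rewrite leq_exp2r // L_gt1.
have tr : total_rank Ng K x <= K * nn.
  apply: (@leq_trans (\sum_(j < K) nn)); first by apply: leq_sum => j _; apply: rank_le.
  by rewrite sum_nat_const card_ord.
have := nn_lt Ng P B; nia.
Qed.

Lemma holds_covers env m : holds (covers K) env m <->
  forall x, x \in P -> x.1 <> nfin /\ exists2 j, j < K & env (tvar j) = x.1.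
Proof.
rewrite holds_all; split.
  move=> h y /(nthP (0, 0)) [i hi <-].
  have := h i (ltn_trans hi (sizeP_lt _ _ _)).
  rewrite holds_imp holds_ltP // updE => /(_ hi).
  rewrite holds_mul holds_not holds_eq eval_P1 ?updE // holds_disj => -[h1 [j]].
  rewrite mem_iota => hj; rewrite holds_eq eval_P1 ?updE //= => h2; split=> //.
  by exists j.
move=> h i _; rewrite holds_imp holds_ltP // updE => hi.
rewrite holds_mul holds_not holds_eq eval_P1 ?updE // holds_disj.
have [h1 [j hj h2]] := h _ (mem_nth (0, 0) hi); split=> //.
by exists j; rewrite ?mem_iota // holds_eq eval_P1 updE.
Qed.

Theorem accepts_correct :
  holds (accepts K) (fun _ => 0) (run (tables K) (fun _ => 0) xpred0) <->
  has_run_incl_omit Ng P B.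
Proof.
rewrite (run_iff_tokens wfN acyc snd B P_size P_nodes).
set m := run _ _ _.
have [fm tm] : full_paths_wins m /\ forall t x, (forall j, j < K -> t j < nn) ->
    (forall j, j < K -> Win (x j)) -> m (addr nn 2 (tup t ++ tup x)) <-> joint t x.
  by apply: tables_correct.
rewrite holds_mul holds_eTab holds_exs.
have -> : map (fun e => eval e (fun=> 0) m) [:: eInit] = [:: ninit] by [].
rewrite (full_win fm (init_node wfN)).
have body env : Win ninit -> (forall j, j < K -> env (tvar j) < nn) ->
    holds (eTab 2 (eTuple K (fun j => Var (tvar j)) ++ eTuple K (fun _ => eInit))) env m <->
    joint (fun j => env (tvar j)) (fun _ => ninit).
  move=> hw ht; rewrite holds_eTab map_cat (@eval_tuple _ (fun j => env (tvar j))) //.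
  by rewrite (@eval_tuple _ (fun _ => ninit)) //; apply: tm.
split=> -[hw hex]; split=> //.
  case: hex => env ha; rewrite 2!holds_mul holds_conj => -[h1 [h2 h3]].
  have ht j : j < K -> env (tvar j) < nn.
    by move=> hj; have := h1 j; rewrite mem_iota => /(_ hj); rewrite holds_ltnn.
  exists (fun j => env (tvar j)); split=> //; first by move/holds_covers: h2.
  exact: (proj1 (body env hw ht) h3).
case: hex => t [ht hc hj].
(* [(y - 10) %/ 3] recovers [j] from [tvar j]. *)
pose env y := if y \in map tvar (iota 0 K) then t ((y - 10) %/ 3) else 0.
have et j : j < K -> env (tvar j) = t j.
  move=> hj'; rewrite /env map_f ?mem_iota //.
  by congr t; rewrite /tvar; lia.
have ht' j : j < K -> env (tvar j) < nn by move=> hj'; rewrite et //; apply: ht.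
exists env.
  split=> y hy; first by rewrite /env (negbTE hy).
  case/mapP: hy => j; rewrite mem_iota => /= hj' ->; rewrite et //.
  by apply: node_lt; apply: ht.
rewrite 2!holds_mul holds_conj; split=> [j|].
  by rewrite mem_iota => hj'; rewrite holds_ltnn //; apply: ht'.
split.
  apply/holds_covers => x xP; have [h1 [j hj' h2]] := hc x xP; split=> //.
  by exists j => //; rewrite et.
by apply/body => //; apply: joint_ext hj => j hj'; rewrite et.
Qed.

End Correctness.

Theorem theorem4p4 (K : nat) :
  PTIME_promise
    (fun x : negotiation * seq (nat * nat) * seq nat =>
       let: (Ng, P, B) := x in
       [/\ wf_negotiation Ng, acyclic Ng, sound Ng, valid_PB Ng P B &
           size (undup P) <= K])
    (fun x => let: (Ng, P, B) := x in enc_instance Ng P B)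
    (fun x => let: (Ng, P, B) := x in has_run_incl_omit Ng P B).
Proof.
have [M [c [d [wfM [hM key]]]]] := stmt_decides (tables K) (accepts K).
exists M, c, d; split=> //; split=> // -[[Ng P] B] [wfN acyc snd [hP _] hK].
have P_nodes x : x \in P -> is_node Ng x.1 by case/hP.
rewrite -(accepts_correct B wfN acyc snd hK P_nodes).
by apply: key; apply: L_gt1.
Qed.
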